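(* For every GKAT expression $e\in\mathrm{Exp}$, the Thompson automaton $\mathcal{X}_e^\iota$ for $e$ is effectively constructible in time $O(|e|)$ and has $\#_\Sigma(e)+1$ (thus $O(|e|)$) states, where $|\mathrm{At}|$ is considered a constant for the time complexity claim, $|e|$ denotes the size of the expression $e$, and $\#_\Sigma(e)$ denotes the number of occurrences of actions in $e$.
   Context: Syntax. Fix disjoint nonempty sets $\Sigma$ (actions) and $T=\{t_1,\dots,t_n\}$ (primitive tests), $T$ finite. Boolean expressions $b,c\in\mathrm{BExp}$ are generated by $0 \mid 1 \mid t\in T \mid b\cdot c \mid b+c \mid \overline{b}$. GKAT expressions $e,f\in\mathrm{Exp}$ are generated by $p\in\Sigma \mid b\in\mathrm{BExp} \mid e\cdot f \mid e+_b f \mid e^{(b)}$. $\equiv_{BA}$ denotes Boolean equivalence, $b\le c$ iff $b+c\equiv_{BA}c$. $\mathrm{At}$ is the finite set of atoms (minimal nonzero elements) of the free Boolean algebra $\mathrm{BExp}/{\equiv_{BA}}$ on $T$. Automata. Let $GX=(2+\Sigma\times X)^{\mathrm{At}}$ with $2=\{0,1\}$. A $G$-coalgebra is a pair $\mathcal{X}=\langle X,\delta^{\mathcal{X}}\rangle$ with $\delta^{\mathcal{X}}:X\to GX$; a $G$-automaton is a $G$-coalgebra with a designated start state. Thompson construction. For $\langle X,\delta\rangle$, $Y\subseteq X$, $h\in GX$, the uniform continuation $\delta[Y,h]:X\to GX$ is $\delta[Y,h](x)(\alpha)=h(\alpha)$ if $x\in Y$ and $\delta(x)(\alpha)=1$,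 and $\delta[Y,h](x)(\alpha)=\delta(x)(\alpha)$ otherwise. $\delta_1+\delta_2$ denotes the coproduct structure on the disjoint union $X+Y$. For each $e\in\mathrm{Exp}$ define a $G$-coalgebra $\mathcal{X}_e=\langle X_e,\delta_e\rangle$ and an initial pseudostate $\iota_e\in GX_e$ by recursion: - $e=b$: $X_b=\emptyset$, $\iota_b(\alpha)=1$ if $\alpha\le b$, else $0$. - $e=p$: $X_p=\{*\}$, $\delta_p( * )(\alpha)=1$ for all $\alpha$, $\iota_p(\alpha)=(p,* )$. - $e=f+_bg$: $X_e=X_f+X_g$, $\delta_e=\delta_f+\delta_g$, $\iota_e(\alpha)=\iota_f(\alpha)$ if $\alpha\le b$, $\iota_g(\alpha)$ if $\alpha\le\overline{b}$. - $e=f\cdot g$: $X_e=X_f+X_g$, $\delta_e=(\delta_f+\delta_g)[X_f,\iota_g]$, $\iota_e(\alpha)=\iota_f(\alpha)$ if $\iota_f(\alpha)\ne1$, $\iota_g(\alpha)$ if $\iota_f(\alpha)=1$. - $e=f^{(b)}$: $X_e=X_f$, $\iota_e(\alpha)=1$ if $\alpha\le\overline{b}$; $0$ if $\alpha\le b$ and $\iota_f(\alpha)=1$; $\iota_f(\alpha)$ if $\alpha\le b$ and $\iota_f(\alpha)\ne1$; $\delta_e=\delta_f[X_f,\iota_e]$. The Thompson automaton is $\mathcal{X}_e^\iota=\langle\{\iota\}+X_e,\delta_e^\iota,\iota\rangle$ with $\delta_e^\iota(x)=\delta_e(x)$ for $x\in X_e$ and $\delta_e^\iota(\iota)=\iota_e$.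 *)

(* Defs.v *)
From mathcomp Require Import all_boot.
From mathcomp Require Import boolp.

Set Implicit Arguments.
Unset Strict Implicit.
Unset Printing Implicit Defensive.

(* The primitive tests t_1, ..., t_n are the elements of 'I_n.  Actions are   *)
(* the elements of an arbitrary type Sigma.                                   *)

Inductive bexp (n : nat) : Type :=
| BZero
| BOne
| BTest of 'I_n
| BAnd of bexp n & bexp n
| BOr of bexp n & bexp n
| BNot of bexp n.

Arguments BZero {n}.
Arguments BOne {n}.

Inductive ba_eq (n : nat) : bexp n -> bexp n -> Prop :=
| ba_refl b : ba_eq b b
| ba_sym b c : ba_eq b c -> ba_eq c b
| ba_trans b c d : ba_eq b c -> ba_eq c d -> ba_eq b d
| ba_and b b' c c' : ba_eq b b' -> ba_eq c c' -> ba_eq (BAnd b c) (BAnd b' c')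
| ba_or b b' c c' : ba_eq b b' -> ba_eq c c' -> ba_eq (BOr b c) (BOr b' c')
| ba_not b b' : ba_eq b b' -> ba_eq (BNot b) (BNot b')
| ba_andC b c : ba_eq (BAnd b c) (BAnd c b)
| ba_orC b c : ba_eq (BOr b c) (BOr c b)
| ba_andA b c d : ba_eq (BAnd b (BAnd c d)) (BAnd (BAnd b c) d)
| ba_orA b c d : ba_eq (BOr b (BOr c d)) (BOr (BOr b c) d)
| ba_andD b c d : ba_eq (BAnd b (BOr c d)) (BOr (BAnd b c) (BAnd b d))
| ba_orD b c d : ba_eq (BOr b (BAnd c d)) (BAnd (BOr b c) (BOr b d))
| ba_and1 b : ba_eq (BAnd b BOne) b
| ba_or0 b : ba_eq (BOr b BZero) b
| ba_andN b : ba_eq (BAnd b (BNot b)) BZero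
| ba_orN b : ba_eq (BOr b (BNot b)) BOne.

Definition ba_le n (b c : bexp n) : Prop := ba_eq (BOr b c) c.

Definition is_atom n (a : bexp n) : Prop :=
  ~ ba_eq a BZero /\
  forall c : bexp n, ba_le c a -> ba_eq c BZero \/ ba_eq c a.

(* A truth assignment alpha names the class of the conjunction                *)
(* c_1 ... c_n, where c_i is t_i or its complement.  These classes are the    *)
(* atoms of the free Boolean algebra, each named exactly once: see            *)
(* [atom_bexp_is_atom] and [is_atom_bexp] below.                              *)
Definition At (n : nat) : finType := {ffun 'I_n -> bool}.

Definition atom_bexp n (alpha : At n) : bexp n :=
  foldr (fun i b => BAnd (if alpha i then BTest i else BNot (BTest i)) b)
        BOne (enum 'I_n).

Definition atom_le n (alpha : At n) (b : bexp n) : Prop :=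
  ba_le (atom_bexp alpha) b.

Section BooleanFacts.
Variable n : nat.
Implicit Types (b c d : bexp n) (alpha : At n).

Fixpoint beval alpha b : bool :=
  match b with
  | BZero => false
  | BOne => true
  | BTest i => alpha i
  | BAnd b c => beval alpha b && beval alpha c
  | BOr b c => beval alpha b || beval alpha c
  | BNot b => ~~ beval alpha b
  end.

Lemma beval_eq alpha b c : ba_eq b c -> beval alpha b = beval alpha c.
Proof.
elim=> //=.
- by move=> b1 b2 b3 _ -> _ ->.
- by move=> b1 b2 b3 b4 _ -> _ ->.
- by move=> b1 b2 b3 b4 _ -> _ ->.
- by move=> b1 b2 _ ->.
- by move=> b1 b2; rewrite andbC.
- by move=> b1 b2; rewrite orbC.
- by move=> b1 b2 b3; rewrite andbA.
- by move=> b1 b2 b3; rewrite orbA.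
- by move=> b1 b2 b3; rewrite andb_orr.
- by move=> b1 b2 b3; rewrite orb_andr.
- by move=> b1; rewrite andbT.
- by move=> b1; rewrite orbF.
- by move=> b1; rewrite andbN.
- by move=> b1; rewrite orbN.
Qed.

Lemma ba_orI b : ba_eq (BOr b b) b.
Proof.
apply: ba_trans (ba_or0 b).
apply: (ba_trans (c := BOr b (BAnd b (BNot b)))); last first.
  by apply: ba_or; [exact: ba_refl | exact: ba_andN].
apply: ba_sym; apply: ba_trans (ba_orD _ _ _) _.
apply: (ba_trans (c := BAnd (BOr b b) BOne)); last exact: ba_and1.
by apply: ba_and; [exact: ba_refl | exact: ba_orN].
Qed.

Lemma ba_or1 b : ba_eq (BOr b BOne) BOne.
Proof.
apply: (ba_trans (c := BOr b (BOr b (BNot b)))).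
  by apply: ba_or; [exact: ba_refl | apply: ba_sym; exact: ba_orN].
apply: ba_trans (ba_orA _ _ _) _.
apply: (ba_trans (c := BOr b (BNot b))); last exact: ba_orN.
by apply: ba_or; [exact: ba_orI | exact: ba_refl].
Qed.

Lemma ba_or_absorb b c : ba_eq (BOr (BAnd b c) b) b.
Proof.
apply: (ba_trans (c := BAnd b (BOr c BOne))).
  apply: ba_sym; apply: ba_trans (ba_andD _ _ _) _.
  by apply: ba_or; [exact: ba_refl | exact: ba_and1].
apply: ba_trans (ba_and1 b).
by apply: ba_and; [exact: ba_refl | exact: ba_or1].
Qed.

Lemma ba_andI b : ba_eq (BAnd b b) b.
Proof.
apply: ba_trans (ba_and1 b).
apply: (ba_trans (c := BAnd b (BOr b (BNot b)))); last first.
  by apply: ba_and; [exact: ba_refl | exact: ba_orN].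
apply: ba_sym; apply: ba_trans (ba_andD _ _ _) _.
apply: (ba_trans (c := BOr (BAnd b b) BZero)); last exact: ba_or0.
by apply: ba_or; [exact: ba_refl | exact: ba_andN].
Qed.

Lemma ba_and_absorb b c : ba_eq (BAnd b (BOr b c)) b.
Proof.
apply: ba_trans (ba_andD _ _ _) _.
apply: (ba_trans (c := BOr b (BAnd b c))).
  by apply: ba_or; [exact: ba_andI | exact: ba_refl].
by apply: ba_trans (ba_orC _ _) _; exact: ba_or_absorb.
Qed.

Lemma ba_leP b c : ba_le b c <-> ba_eq (BAnd b c) b.
Proof.
split=> H.
  apply: ba_trans (ba_and_absorb b c).
  by apply: ba_and; [exact: ba_refl | apply: ba_sym].
apply: (ba_trans (c := BOr (BAnd c b) c)); last exact: ba_or_absorb.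
apply: ba_or; last exact: ba_refl.
by apply: ba_trans (ba_andC _ _); apply: ba_sym.
Qed.

Lemma ba_le_refl b : ba_le b b. Proof. exact: ba_orI. Qed.

Lemma ba_le_trans b c d : ba_le b c -> ba_le c d -> ba_le b d.
Proof.
rewrite /ba_le => H1 H2.
apply: (ba_trans (c := BOr b (BOr c d))).
  by apply: ba_or; [exact: ba_refl | apply: ba_sym].
apply: ba_trans (ba_orA _ _ _) _.
apply: ba_trans (H2).
by apply: ba_or; [exact: H1 | exact: ba_refl].
Qed.

Lemma ba_le_anti b c : ba_le b c -> ba_le c b -> ba_eq b c.
Proof.
move=> H1 H2; apply: ba_trans (H1); apply: ba_sym.
by apply: ba_trans (H2); exact: ba_orC.
Qed.

Lemma ba_le_eqr b c d : ba_eq c d -> ba_le b c -> ba_le b d.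
Proof.
move=> H1 H2; apply: ba_trans (H1); apply: ba_trans (H2).
by apply: ba_or; [exact: ba_refl | apply: ba_sym].
Qed.

Lemma ba_le_andl b c : ba_le (BAnd b c) b.
Proof. exact: ba_or_absorb. Qed.

Lemma ba_le_andr b c : ba_le (BAnd b c) c.
Proof.
apply: ba_trans (ba_or_absorb c b).
by apply: ba_or; [exact: ba_andC | exact: ba_refl].
Qed.

Lemma ba_le_orl b c : ba_le b (BOr b c).
Proof.
apply: ba_trans (ba_orA _ _ _) _.
by apply: ba_or; [exact: ba_orI | exact: ba_refl].
Qed.

Lemma ba_le_orr b c : ba_le c (BOr b c).
Proof. exact: ba_le_eqr (ba_orC _ _) (ba_le_orl c b). Qed.

Lemma ba_le_and b c d : ba_le b c -> ba_le b d -> ba_le b (BAnd c d).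
Proof.
rewrite /ba_le => H1 H2; apply: ba_trans (ba_orD _ _ _) _.
by apply: ba_and.
Qed.

Lemma ba_le1 b : ba_le b BOne. Proof. exact: ba_or1. Qed.

Lemma ba_le0 b : ba_le BZero b.
Proof. by apply: ba_trans (ba_orC _ _) _; exact: ba_or0. Qed.

Lemma ba_le_eq b c : ba_eq b c -> ba_le b c.
Proof. by move=> H; apply: ba_le_eqr H _; exact: ba_le_refl. Qed.

Lemma ba_le_not b c : ba_eq (BAnd b c) BZero -> ba_le b (BNot c).
Proof.
move=> H; apply/ba_leP.
apply: (ba_trans (c := BAnd b (BOr c (BNot c)))).
  apply: ba_sym; apply: ba_trans (ba_andD _ _ _) _.
  apply: (ba_trans (c := BOr BZero (BAnd b (BNot c)))).
    by apply: ba_or; [exact: H | exact: ba_refl].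
  by apply: ba_trans (ba_orC _ _) _; exact: ba_or0.
apply: ba_trans (ba_and1 b).
by apply: ba_and; [exact: ba_refl | exact: ba_orN].
Qed.

Lemma ba_le_contra b c : ba_le b c -> ba_le b (BNot c) -> ba_eq b BZero.
Proof.
move=> H1 H2; apply: ba_le_anti; last exact: ba_le0.
exact: ba_le_eqr (ba_andN c) (ba_le_and H1 H2).
Qed.

Lemma beval_le alpha b c : ba_le b c -> beval alpha b -> beval alpha c.
Proof. by move/(beval_eq alpha) => /= <- ->. Qed.

Lemma beval_atom alpha beta : beval beta (atom_bexp alpha) = (beta == alpha).
Proof.
have E s : beval beta
    (foldr (fun i b => BAnd (if alpha i then BTest i else BNot (BTest i)) b)
       BOne s) = all (fun i => beta i == alpha i) s.
  by elim: s => //= i s ->; case: (alpha i) => /=; case: (beta i).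
rewrite /atom_bexp E; apply/allP/eqP => [H | -> //].
by apply/ffunP => i; apply/eqP; apply: H; rewrite mem_enum.
Qed.

Lemma atom_nonzero alpha : ~ ba_eq (atom_bexp alpha) BZero.
Proof. by move/(beval_eq alpha) => /=; rewrite beval_atom eqxx. Qed.

Lemma atom_lit alpha i :
  ba_le (atom_bexp alpha) (if alpha i then BTest i else BNot (BTest i)).
Proof.
rewrite /atom_bexp; have: i \in enum 'I_n by rewrite mem_enum.
elim: (enum 'I_n) => //= j s IH; rewrite inE => /orP[/eqP<- | /IH H].
  exact: ba_le_andl.
by apply: ba_le_trans (H); exact: ba_le_andr.
Qed.

Lemma atom_decide alpha b :
  ba_le (atom_bexp alpha) (if beval alpha b then b else BNot b).
Proof.
elim: b => [||i|b IHb c IHc|b IHb c IHc|b IHb] /=.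
- apply: ba_le_not; apply: ba_le_anti; [exact: ba_le_andr | exact: ba_le0].
- exact: ba_le1.
- exact: atom_lit.
- case: (beval alpha b) IHb => /= IHb.
    case: (beval alpha c) IHc => /= IHc; first exact: ba_le_and.
    apply: ba_le_not; apply: (ba_le_contra (c := c)).
      exact: ba_le_trans (ba_le_andr _ _) (ba_le_andr _ _).
    exact: ba_le_trans (ba_le_andl _ _) IHc.
  apply: ba_le_not; apply: (ba_le_contra (c := b)).
    exact: ba_le_trans (ba_le_andr _ _) (ba_le_andl _ _).
  exact: ba_le_trans (ba_le_andl _ _) IHb.
- case: (beval alpha b) IHb => /= IHb.
    exact: ba_le_trans IHb (ba_le_orl _ _).
  case: (beval alpha c) IHc => /= IHc.
    exact: ba_le_trans IHc (ba_le_orr _ _).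
  apply: ba_le_not; apply: ba_trans (ba_andD _ _ _) _.
  apply: ba_trans (ba_or0 _); apply: ba_or.
    apply: (ba_le_contra (c := b)); first exact: ba_le_andr.
    exact: ba_le_trans (ba_le_andl _ _) IHb.
  apply: (ba_le_contra (c := c)); first exact: ba_le_andr.
  exact: ba_le_trans (ba_le_andl _ _) IHc.
- case: (beval alpha b) IHb => //= IHb.
  apply: ba_le_not; apply: (ba_le_contra (c := b)).
    exact: ba_le_trans (ba_le_andl _ _) IHb.
  exact: ba_le_andr.
Qed.

Lemma atom_leE alpha b : `[< atom_le alpha b >] = beval alpha b.
Proof.
apply/asboolP/idP => [/(beval_le (alpha := alpha)) | H].
  by apply; rewrite beval_atom.
by have := atom_decide alpha b; rewrite H.
Qed.

Lemma atom_le_not alpha b : atom_le alpha (BNot b) <-> ~ atom_le alpha b.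
Proof.
split=> [/asboolP | H]; first by rewrite atom_leE /= -atom_leE => /asboolP.
by apply/asboolP; rewrite atom_leE /= -atom_leE; apply/asboolP.
Qed.

Lemma atom_bexp_is_atom alpha : is_atom (atom_bexp alpha).
Proof.
split=> [|c Hc]; first exact: atom_nonzero.
have := atom_decide alpha c; case: (beval alpha c) => H.
  by right; apply: ba_le_anti.
left; apply: (ba_le_contra (c := c)); first exact: ba_le_refl.
exact: ba_le_trans Hc H.
Qed.

Lemma ba_complete0 b : (forall alpha, beval alpha b = false) -> ba_eq b BZero.
Proof.
move=> Hb.
have K (s : seq 'I_n) : uniq s -> forall d,
    (forall alpha, ba_le (BAnd b (foldr (fun i c =>
      BAnd (if alpha i then BTest i else BNot (BTest i)) c) BOne s)) d) ->
    ba_le b d.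
  elim: s => [_ d H | i s IH /= /andP[is_ us] d H].
    by apply: ba_le_trans (H [ffun=> true]); apply: ba_le_eq;
       apply: ba_sym; exact: ba_and1.
  apply: IH => // alpha.
  set c := foldr _ _ _.
  have Hv v : ba_le
     (BAnd b (BAnd (if v then BTest i else BNot (BTest i)) c)) d.
    have := H [ffun j => if j == i then v else alpha j].
    rewrite ffunE eqxx.
    suff -> : foldr (fun i0 c0 => BAnd
        (if [ffun j => if j == i then v else alpha j] i0
         then BTest i0 else BNot (BTest i0)) c0) BOne s = c by [].
    rewrite /c; elim: s is_ {us H c} => //= j s IHs.
    rewrite inE negb_or => /andP[ij /IHs ->]; rewrite ffunE.
    by rewrite eq_sym (negbTE ij).
  have E : ba_eq (BAnd b c)
      (BOr (BAnd b (BAnd (BTest i) c)) (BAnd b (BAnd (BNot (BTest i)) c))).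
    apply: ba_trans (ba_andD _ _ _).
    apply: ba_and; first exact: ba_refl.
    apply: ba_trans (ba_sym (ba_and1 _)) _.
    apply: (ba_trans (c := BAnd c (BOr (BTest i) (BNot (BTest i))))).
      by apply: ba_and; [exact: ba_refl | apply: ba_sym; exact: ba_orN].
    apply: ba_trans (ba_andD _ _ _) _.
    by apply: ba_or; exact: ba_andC.
  apply: ba_le_trans (ba_le_eq E) _.
  rewrite /ba_le; apply: ba_trans (ba_sym (ba_orA _ _ _)) _.
  apply: ba_trans (Hv true).
  by apply: ba_or; [exact: ba_refl | exact: (Hv false)].
apply: ba_le_anti; last exact: ba_le0.
apply: (K (enum 'I_n)); first exact: enum_uniq.
move=> alpha; apply: ba_le_eq; apply: (ba_le_contra (c := b)).
  exact: ba_le_andl.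
have := atom_decide alpha b; rewrite Hb.
by apply: ba_le_trans; exact: ba_le_andr.
Qed.

Lemma is_atom_bexp a :
  is_atom a -> exists! alpha : At n, ba_eq a (atom_bexp alpha).
Proof.
case=> nz mn.
have [alpha Ha] : exists alpha, beval alpha a.
  apply: contra_notP nz => nex; apply: ba_complete0 => alpha.
  by apply/negbTE/negP => H; apply: nex; exists alpha.
have le_a : ba_le (atom_bexp alpha) a by have := atom_decide alpha a; rewrite Ha.
exists alpha; split.
  by case: (mn _ le_a) => [/atom_nonzero // |]; exact: ba_sym.
move=> beta /(beval_eq alpha); rewrite Ha beval_atom.
by move/esym/eqP.
Qed.

End BooleanFacts.

Inductive exp (n : nat) (Sigma : Type) : Type :=
| Do of Sigma
| Test of bexp n
| Seq of exp n Sigma & exp n Sigma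
| Cond of bexp n & exp n Sigma & exp n Sigma  (* Cond b f g is f +_b g *)
| Loop of bexp n & exp n Sigma.               (* Loop b f is f^(b) *)

Fixpoint bsize n (b : bexp n) : nat :=
  match b with
  | BZero | BOne | BTest _ => 1
  | BAnd b c | BOr b c => (bsize b + bsize c).+1
  | BNot b => (bsize b).+1
  end.

Fixpoint esize n Sigma (e : exp n Sigma) : nat :=
  match e with
  | Do _ => 1
  | Test b => bsize b
  | Seq f g => (esize f + esize g).+1
  | Cond b f g => (bsize b + esize f + esize g).+1
  | Loop b f => (bsize b + esize f).+1
  end.

Fixpoint nact n Sigma (e : exp n Sigma) : nat :=
  match e with
  | Do _ => 1
  | Test _ => 0
  | Seq f g | Cond _ f g => nact f + nact g
  | Loop _ f => nact f
  end.

(* In 2 + Sigma * X, the elements 0 and 1 of 2 are inl false and inl true.    *)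
Definition GF (n : nat) (Sigma X : Type) : Type :=
  At n -> (bool + Sigma * X)%type.

Definition out_map Sigma X Y (h : X -> Y) (o : bool + Sigma * X) :
    (bool + Sigma * Y)%type :=
  match o with
  | inl v => inl v
  | inr (p, x) => inr (p, h x)
  end.

Definition gmap n Sigma X Y (h : X -> Y) (k : GF n Sigma X) : GF n Sigma Y :=
  fun alpha => out_map h (k alpha).

Definition is_acc Sigma X (o : bool + Sigma * X) : bool :=
  if o is inl true then true else false.

Definition unif_cont n Sigma X (delta : X -> GF n Sigma X)
    (Y : pred X) (h : GF n Sigma X) : X -> GF n Sigma X :=
  fun x alpha => if Y x && is_acc (delta x alpha) then h alpha
                 else delta x alpha.

Definition coprod n Sigma X Y (d1 : X -> GF n Sigma X) (d2 : Y -> GF n Sigma Y) :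
    X + Y -> GF n Sigma (X + Y) :=
  fun z => match z with
           | inl x => gmap inl (d1 x)
           | inr y => gmap inr (d2 y)
           end.

Definition in_left X Y : pred (X + Y) :=
  fun z => if z is inl _ then true else false.

(* Only finite carriers occur, hence a finType of states. *)
Record pseudo_coalg (n : nat) (Sigma : Type) := PseudoCoalg {
  pc_state : finType;
  pc_delta : pc_state -> GF n Sigma pc_state;
  pc_iota : GF n Sigma pc_state
}.

Record automaton (n : nat) (Sigma : Type) := Automaton {
  state : finType;
  trans : state -> GF n Sigma state;
  start : state
}.

Definition thompson_test n Sigma (b : bexp n) : pseudo_coalg n Sigma :=
  @PseudoCoalg n Sigma void
    (fun x => match x with end)
    (fun alpha => inl `[< atom_le alpha b >]).

Definition thompson_do n Sigma (p : Sigma) : pseudo_coalg n Sigma :=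
  @PseudoCoalg n Sigma unit
    (fun _ _ => inl true)
    (fun _ => inr (p, tt)).

(* For an atom, not being below b is being below its complement: see          *)
(* [atom_le_not].                                                             *)
Definition thompson_cond n Sigma (b : bexp n) (F G : pseudo_coalg n Sigma) :
    pseudo_coalg n Sigma :=
  @PseudoCoalg n Sigma (pc_state F + pc_state G)%type
    (coprod (@pc_delta _ _ F) (@pc_delta _ _ G))
    (fun alpha => if `[< atom_le alpha b >] then gmap inl (@pc_iota _ _ F) alpha
                  else gmap inr (@pc_iota _ _ G) alpha).

Definition thompson_seq n Sigma (F G : pseudo_coalg n Sigma) :
    pseudo_coalg n Sigma :=
  @PseudoCoalg n Sigma (pc_state F + pc_state G)%type
    (unif_cont (coprod (@pc_delta _ _ F) (@pc_delta _ _ G))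
       (@in_left _ _) (gmap inr (@pc_iota _ _ G)))
    (fun alpha => if is_acc (pc_iota F alpha) then gmap inr (@pc_iota _ _ G) alpha
                  else gmap inl (@pc_iota _ _ F) alpha).

Definition loop_iota n Sigma (b : bexp n) (F : pseudo_coalg n Sigma) :
    GF n Sigma (pc_state F) :=
  fun alpha => if `[< atom_le alpha (BNot b) >] then inl true
               else if is_acc (pc_iota F alpha) then inl false
               else pc_iota F alpha.

Definition thompson_loop n Sigma (b : bexp n) (F : pseudo_coalg n Sigma) :
    pseudo_coalg n Sigma :=
  @PseudoCoalg n Sigma (pc_state F)
    (unif_cont (@pc_delta _ _ F) predT (loop_iota b F))
    (loop_iota b F).

Fixpoint thompson n Sigma (e : exp n Sigma) : pseudo_coalg n Sigma :=
  match e with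
  | Do p => thompson_do n p
  | Test b => thompson_test Sigma b
  | Seq f g => thompson_seq (thompson f) (thompson g)
  | Cond b f g => thompson_cond b (thompson f) (thompson g)
  | Loop b f => thompson_loop b (thompson f)
  end.

Definition thompson_automaton n Sigma (e : exp n Sigma) : automaton n Sigma :=
  let X := thompson e in
  @Automaton n Sigma (unit + pc_state X)%type
    (fun z => match z with
              | inl _ => gmap inr (@pc_iota _ _ X)
              | inr x => gmap inr (pc_delta x)
              end)
    (inl tt).

(* Cost model: a unit-cost random access machine with structured control.     *)
(* A word is a number or an action symbol.  Action symbols can only be        *)
(* copied.  Arithmetic only adds or subtracts a constant of the program, so   *)
(* that in t steps numbers grow by O(t): unit cost hides no long arithmetic.  *)
Inductive word (Sigma : Type) : Type :=
| Num of nat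
| Sym of Sigma.

Arguments Num {Sigma} _.

Inductive cmd : Type :=
| Skip
| Const of nat & nat         (* Const r k     : r := k                 *)
| Move of nat & nat          (* Move r r'     : r := r'                *)
| AddC of nat & nat & nat    (* AddC r r' k   : r := r' + k            *)
| SubC of nat & nat & nat    (* SubC r r' k   : r := r' - k, truncated *)
| Fetch of nat & nat         (* Fetch r r'    : r := mem[r']           *)
| Store of nat & nat         (* Store r r'    : mem[r] := r'           *)
| Then of cmd & cmd
| IfEq of nat & nat & cmd & cmd  (* IfEq r k c c' : if r = k then c else c' *)
| While of nat & cmd.            (* While r c     : while r <> 0 do c       *)

Record store (Sigma : Type) := Mk_store {
  reg : nat -> word Sigma;
  mem : nat -> word Sigma
}.

Definition upd Sigma (m : nat -> word Sigma) (i : nat) (w : word Sigma) :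
    nat -> word Sigma :=
  fun j => if j == i then w else m j.

Definition set_reg Sigma (s : store Sigma) r w : store Sigma :=
  Mk_store (upd (reg s) r w) (mem s).

Definition set_mem Sigma (s : store Sigma) a w : store Sigma :=
  Mk_store (reg s) (upd (mem s) a w).

(* [exec c s t s']: started in s, the command c halts in s' after t steps.    *)
(* An arithmetic operation, test or memory access on a symbol is stuck.       *)
Inductive exec (Sigma : Type) : cmd -> store Sigma -> nat -> store Sigma -> Prop :=
| exec_skip s : exec Skip s 1 s
| exec_const r k s : exec (Const r k) s 1 (set_reg s r (Num k))
| exec_move r r' s : exec (Move r r') s 1 (set_reg s r (reg s r'))
| exec_addc r r' k s m : reg s r' = Num m ->
    exec (AddC r r' k) s 1 (set_reg s r (Num (m + k)))
| exec_subc r r' k s m : reg s r' = Num m ->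
    exec (SubC r r' k) s 1 (set_reg s r (Num (m - k)))
| exec_fetch r r' s a : reg s r' = Num a ->
    exec (Fetch r r') s 1 (set_reg s r (mem s a))
| exec_store r r' s a : reg s r = Num a ->
    exec (Store r r') s 1 (set_mem s a (reg s r'))
| exec_then c c' s s' s'' t t' : exec c s t s' -> exec c' s' t' s'' ->
    exec (Then c c') s (t + t') s''
| exec_if_true r k c c' s s' t : reg s r = Num k -> exec c s t s' ->
    exec (IfEq r k c c') s t.+1 s'
| exec_if_false r k m c c' s s' t : reg s r = Num m -> m <> k ->
    exec c' s t s' -> exec (IfEq r k c c') s t.+1 s'
| exec_while_stop r c s : reg s r = Num 0 -> exec (While r c) s 1 s
| exec_while_step r m c s s' s'' t t' : reg s r = Num m.+1 ->
    exec c s t s' -> exec (While r c) s' t' s'' ->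
    exec (While r c) s (t + t').+1 s''.

Lemma exec_det Sigma c (s : store Sigma) t1 s1 t2 s2 :
  exec c s t1 s1 -> exec c s t2 s2 -> t1 = t2 /\ s1 = s2.
Proof.
move=> H; elim: H t2 s2 => [s0|r k s0|r r' s0|r r' k s0 m E|r r' k s0 m E
  |r r' s0 a E|r r' s0 a E|c1 c2 s0 s' s'' t t' _ IH1 _ IH2
  |r k c1 c2 s0 s' t E _ IH|r k m c1 c2 s0 s' t E nk _ IH|r c1 s0 E
  |r m c1 s0 s' s'' t t' E _ IH1 _ IH2] t2 s2 H;
  inversion H; subst; try (split; congruence); try congruence.
- by have [? ?] : t = t0 /\ s' = s'0 by [apply: IH1]; subst;
     have [-> ->] : t' = t'0 /\ s'' = s2 by [apply: IH2].
- by have [-> ->] : t = t0 /\ s' = s2 by [apply: IH].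
- by have [-> ->] : t = t0 /\ s' = s2 by [apply: IH].
- by have [? ?] : t = t0 /\ s' = s'0 by [apply: IH1]; subst;
     have [-> ->] : t' = t'0 /\ s'' = s2 by [apply: IH2].
Qed.

(* Input format: the expression in postfix notation, one token per node of    *)
(* the syntax tree, each token being an operator tag and an argument word.    *)
Fixpoint btokens n Sigma (b : bexp n) : seq (nat * word Sigma) :=
  match b with
  | BZero => [:: (0, Num 0)]
  | BOne => [:: (1, Num 0)]
  | BTest i => [:: (2, Num (nat_of_ord i))]
  | BAnd b c => btokens Sigma b ++ btokens Sigma c ++ [:: (3, Num 0)]
  | BOr b c => btokens Sigma b ++ btokens Sigma c ++ [:: (4, Num 0)]
  | BNot b => btokens Sigma b ++ [:: (5, Num 0)]
  end.

Fixpoint tokens n Sigma (e : exp n Sigma) : seq (nat * word Sigma) :=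
  match e with
  | Do p => [:: (6, Sym p)]
  | Test b => btokens Sigma b
  | Seq f g => tokens f ++ tokens g ++ [:: (7, Num 0)]
  | Cond b f g => btokens Sigma b ++ tokens f ++ tokens g ++ [:: (8, Num 0)]
  | Loop b f => btokens Sigma b ++ tokens f ++ [:: (9, Num 0)]
  end.

Definition input_words n Sigma (e : exp n Sigma) : seq (word Sigma) :=
  flatten [seq [:: Num tok.1; tok.2] | tok <- tokens e].

(* Register 0 holds the number of tokens, the words of the tokens are at      *)
(* addresses 0, 1, 2, ... and everything else is 0.                           *)
Definition input_store n Sigma (e : exp n Sigma) : store Sigma :=
  Mk_store (upd (fun _ => Num 0) 0 (Num (size (tokens e))))
           (nth (Num 0) (input_words e)).

(* An output in 2 + Sigma * X stored at address a, states being numbered by   *)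
(* nu: one word 0 or 1, or three words 2, p, nu x.                            *)
Definition stored_out Sigma X (nu : X -> nat) (m : nat -> word Sigma) (a : nat)
    (o : bool + Sigma * X) : Prop :=
  match o with
  | inl v => m a = Num (nat_of_bool v)
  | inr (p, x) => [/\ m a = Num 2, m a.+1 = Sym p & m a.+2 = Num (nu x)]
  end.

(* The store contains the transition table of A, for some numbering nu of its *)
(* states by 0, ..., #|state A| - 1.  Registers 0, 1 and 2 hold the address   *)
(* of the table, the number of states and the number of the start state.  The *)
(* table has one row per state and three words per atom in each row.          *)
Definition represents n Sigma (s : store Sigma) (A : automaton n Sigma) : Prop :=
  exists (base : nat) (nu : state A -> 'I_#|state A|),
    [/\ bijective nu,
        reg s 0 = Num base,
        reg s 1 = Num #|state A|,
        reg s 2 = Num (nat_of_ord (nu (start A))) &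
        forall (x : state A) (alpha : At n),
          stored_out (fun y => nat_of_ord (nu y)) (mem s)
            (base + 3 * (nu x * #|At n| + enum_rank alpha))
            (trans x alpha)].

(* The program and the constant are chosen before the expression. *)
Definition constructible_in_linear_time n Sigma
    (A : exp n Sigma -> automaton n Sigma) : Prop :=
  exists (P : cmd) (C : nat), forall e : exp n Sigma,
    exists (t : nat) (s : store Sigma),
      [/\ exec P (input_store e) t s, t <= C * esize e & represents s (A e)].

(* Main.v *)
(* Carrying out the uniform continuations literally would take quadratic      *)
(* time.  Instead, note that uniform continuations compose: if the accepting  *)
(* outputs of X_e are to be replaced by k, then in e = f g those of X_g are   *)
(* to be replaced by k and those of X_f by iota_g |> k, where (h |> k) alpha  *)
(* is k alpha if h alpha = 1 and h alpha otherwise; in e = f +_b g both are   *)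
(* to be replaced by k; and in e = f^(b) those of X_f by iota_e |> k.  The    *)
(* row of the state of an action is then simply the k that reaches it.        *)
(* Hence two passes over the postfix input suffice, with constant work per    *)
(* token: the first one, from left to right, numbers the actions and computes *)
(* all the iota_f; the second one, from right to left, distributes the        *)
(* continuations, starting with k = 1, and writes the rows of the table.      *)
(* Boolean subexpressions go through the first pass as tests.                 *)

Require Import Defs.
From mathcomp Require Import all_boot.
From mathcomp Require Import zify.
Import Defs.

Set Implicit Arguments.
Unset Strict Implicit.
Unset Printing Implicit Defensive.

(** Only [Do] contributes a state, so [thompson e] has [nact e] states ([card_thompson]), and the
    start state adds one.

    For the time bound, write h |> k for [then_row h k]. The operation |> is associative, so the
    rewritings that the enclosing operators inflict on the row of a state amount to a single
    continuation ([delta_row_seql], [delta_row_loop]). The state of an action accepts everywhere, so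
    its final row is the continuation that reaches it; at the root the continuation is [accept_row],
    a right unit of |>.

    Memory holds one frame per token. In postfix notation the last operand ends just before its
    operator, and the recorded position of its first token leads to the operand on its left; hence
    an operator reaches all its operands in boundedly many steps. Read from left to right, operands
    precede operators, so initial rows are synthesised bottom-up ([compiles_tokens]). Read from
    right to left, operators precede operands, so continuations are inherited top-down ([cont_okP]).
    Both invariants speak of a segment of tokens at an arbitrary position and bound the addresses
    written, which lets them compose along the syntax tree.

    A loop body contains no inner loop: dispatch and row operations are unrolled over tags, tests
    and atoms. Its cost is therefore at most [max_steps], a number depending on [n] alone
    ([exec_max_steps]). Every loop runs once per token, and there are [esize e] tokens
    ([size_tokens]); [runs_thompson_program] adds up the costs. *)

Fixpoint loop_free (c : cmd) : bool :=
  match c with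
  | Then c c' | IfEq _ _ c c' => loop_free c && loop_free c'
  | While _ _ => false
  | _ => true
  end.

Fixpoint max_steps (c : cmd) : nat :=
  match c with
  | Then c c' => max_steps c + max_steps c'
  | IfEq _ _ c c' => (maxn (max_steps c) (max_steps c')).+1
  | _ => 1
  end.

(** Tests compare with constants only, so dispatch on a register is a chain of comparisons whose
    length is fixed with the program. *)
Fixpoint switch (r : nat) (f : nat -> cmd) (k : nat) : cmd :=
  if k is k'.+1 then IfEq r k' (f k') (switch r f k') else Skip.

Lemma loop_free_switch r f k :
  (forall i, loop_free (f i)) -> loop_free (switch r f k).
Proof. by move=> Hf; elim: k => // k IH; rewrite /switch /= Hf. Qed.

(** * Total correctness and running time of commands *)

Section WeakestPrecondition.
Variable Sigma : Type.
Implicit Types (s : store Sigma) (c : cmd) (Q : store Sigma -> Prop).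

Lemma exec_max_steps c s t s' :
  exec c s t s' -> loop_free c -> t <= max_steps c.
Proof.
elim=> //= {c s t s'}.
- by move=> c c' s s' s'' t t' _ IH _ IH' /andP[/IH ? /IH' ?]; lia.
- by move=> r k c c' s s' t _ _ IH /andP[/IH ? _]; lia.
- by move=> r k m c c' s s' t _ _ _ IH /andP[_ /IH ?]; lia.
Qed.

(** Termination without a step count: for loop-free code [exec_max_steps] recovers the time
    afterwards, which keeps specifications free of step arithmetic. *)
Definition wp c s Q : Prop := exists t s', exec c s t s' /\ Q s'.

Lemma wp_impl c s Q Q' : wp c s Q -> (forall s', Q s' -> Q' s') -> wp c s Q'.
Proof. by move=> [t [s' [E q]]] H; exists t, s'; split; last exact: H. Qed.

Lemma wp_skip s Q : Q s -> wp Skip s Q.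
Proof. by move=> q; exists 1, s; split=> //; constructor. Qed.

Lemma wp_const r k s Q : Q (set_reg s r (Num k)) -> wp (Const r k) s Q.
Proof. by move=> q; do 2!eexists; split; first constructor. Qed.

Lemma wp_move r r' s Q : Q (set_reg s r (reg s r')) -> wp (Move r r') s Q.
Proof. by move=> q; do 2!eexists; split; first constructor. Qed.

Lemma wp_addc m r r' k s Q :
  reg s r' = Num m -> Q (set_reg s r (Num (m + k))) -> wp (AddC r r' k) s Q.
Proof. by move=> E q; do 2!eexists; split; first (constructor; exact: E). Qed.

Lemma wp_subc m r r' k s Q :
  reg s r' = Num m -> Q (set_reg s r (Num (m - k))) -> wp (SubC r r' k) s Q.
Proof. by move=> E q; do 2!eexists; split; first (constructor; exact: E). Qed.

Lemma wp_fetch a r r' s Q :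
  reg s r' = Num a -> Q (set_reg s r (mem s a)) -> wp (Fetch r r') s Q.
Proof. by move=> E q; do 2!eexists; split; first (constructor; exact: E). Qed.

Lemma wp_store a r r' s Q :
  reg s r = Num a -> Q (set_mem s a (reg s r')) -> wp (Store r r') s Q.
Proof. by move=> E q; do 2!eexists; split; first (constructor; exact: E). Qed.

Lemma wp_then c c' s Q : wp c s (fun s' => wp c' s' Q) -> wp (Then c c') s Q.
Proof.
move=> [t [s' [E [t' [s'' [E' q]]]]]].
by exists (t + t'), s''; split=> //; exact: exec_then E E'.
Qed.

Lemma wp_ifeq m r k c c' s Q :
  reg s r = Num m -> wp (if m == k then c else c') s Q -> wp (IfEq r k c c') s Q.
Proof.
move=> E; case: eqP => [mk | mk] [t [s' [H q]]]; exists t.+1, s'; split=> //.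
  by apply: exec_if_true H; rewrite E mk.
exact: exec_if_false E mk H.
Qed.

Lemma wp_switch i r f k s Q :
  reg s r = Num i -> i < k -> wp (f i) s Q -> wp (switch r f k) s Q.
Proof.
move=> E; elim: k => // k IH ik q; apply: (wp_ifeq E).
by case: eqP => [<- // | ik']; apply: IH => //; lia.
Qed.

(* Stated by continuation, so that the body need not be unrolled a known      *)
(* number of times.                                                           *)
Definition leads c s d s' : Prop :=
  forall t s'', exec (While 0 c) s' t s'' ->
    exists2 t', exec (While 0 c) s t' s'' & t' <= t + d.

Lemma leads_refl c s : leads c s 0 s.
Proof. by move=> t s' E; exists t => //; lia. Qed.

Lemma leads_trans c s s' s'' d d' :
  leads c s d s' -> leads c s' d' s'' -> leads c s (d + d') s''.
Proof.
move=> H H' t u /H'[t1 /H[t2 E l2] l1]; exists t2 => //; lia.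
Qed.

Lemma leads_step c s m Q :
  loop_free c -> reg s 0 = Num m.+1 -> wp c s Q ->
  exists2 s', leads c s (max_steps c).+1 s' & Q s'.
Proof.
move=> lf E [t [s' [H q]]]; exists s' => // t' s'' H'.
exists (t + t').+1; first exact: exec_while_step E H H'.
by have := exec_max_steps H lf; lia.
Qed.

Lemma leads_exec c s d s' :
  leads c s d s' -> reg s' 0 = Num 0 ->
  exists2 t, exec (While 0 c) s t s' & t <= d.+1.
Proof. by move=> L /exec_while_stop /L[t Et lt]; exists t. Qed.

(* Registers 2 and 3 are the scratch registers of the row operations.         *)
Definition keeps s s' : Prop :=
  forall r, r != 2 -> r != 3 -> reg s' r = reg s r.

Lemma keeps_refl s : keeps s s. Proof. by []. Qed.

Lemma keeps_trans s s' s'' : keeps s s' -> keeps s' s'' -> keeps s s''.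
Proof. by move=> H H' r r2 r3; rewrite H' // H. Qed.

Definition same_but lo len (m m' : nat -> word Sigma) : Prop :=
  forall a, (a < lo) || (lo + len <= a) -> m' a = m a.

End WeakestPrecondition.

(** * Straight-line code for rows of the transition table *)

Section Rows.
Variables (n : nat) (Sigma : Type).
Implicit Types (s : store Sigma) (alpha : At n) (rho : GF n Sigma nat).

Definition width : nat := 3 * #|At n|.

Definition slot alpha : nat := 3 * enum_rank alpha.

Lemma slot_lt alpha : slot alpha + 3 <= width.
Proof. by rewrite /slot /width addnC -mulnS leq_mul2l ltn_ord. Qed.

Lemma slot_neq alpha beta :
  alpha != beta -> (slot alpha + 3 <= slot beta) || (slot beta + 3 <= slot alpha).
Proof.
move=> ab; have : enum_rank alpha != enum_rank beta :> nat.
  by apply: contra ab => /eqP /ord_inj /enum_rank_inj ->.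
rewrite /slot; lia.
Qed.

(** Targets are already numbers, hence the numbering [id]: the row of an operand can be copied
    verbatim into that of a compound expression. *)
Definition row_at (m : nat -> word Sigma) a rho : Prop :=
  forall alpha, stored_out id m (a + slot alpha) (rho alpha).

Lemma stored_out_same (m m' : nat -> word Sigma) a b o :
  (forall i, i < 3 -> m' (b + i) = m (a + i)) ->
  stored_out (id : nat -> nat) m a o -> stored_out id m' b o.
Proof.
move=> E; have := E 0 isT; have := E 1 isT; have := E 2 isT.
by rewrite !addn0 !addn1 !addn2 => E2 E1 E0; case: o => [v | [p x]] /=;
   rewrite E0 // E1 E2.
Qed.

Lemma row_at_same (m m' : nat -> word Sigma) a rho :
  (forall i, i < width -> m' (a + i) = m (a + i)) ->
  row_at m a rho -> row_at m' a rho.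
Proof.
move=> E H alpha; apply: stored_out_same (H alpha) => i i3.
by rewrite -addnA E //; have := slot_lt alpha; lia.
Qed.

Lemma row_at_ext m a rho rho' : rho =1 rho' -> row_at m a rho -> row_at m a rho'.
Proof. by move=> E H alpha; rewrite -E. Qed.

Definition out_tag (o : bool + Sigma * nat) : nat :=
  if o is inl v then nat_of_bool v else 2.

Lemma stored_out_tag m a o :
  stored_out (id : nat -> nat) m a o -> m a = Num (out_tag o).
Proof. by case: o => [v | [p x]] //= []. Qed.

Definition fills c s a o : Prop :=
  wp c s (fun s' => [/\ keeps s s', same_but a 3 (mem s) (mem s')
                      & stored_out id (mem s') a o]).

Definition put_const D off (v : At n -> bool) alpha : cmd :=
  Then (Const 3 (v alpha)) (Then (AddC 2 D (off + slot alpha)) (Store 2 3)).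

Definition put_word D off r : cmd := Then (AddC 2 D off) (Store 2 r).

Definition put_act D off rp rc alpha : cmd :=
  Then (Const 3 2) (Then (put_word D (off + slot alpha) 3)
    (Then (put_word D (off + slot alpha + 1) rp)
          (put_word D (off + slot alpha + 2) rc))).

Definition copy_word D off X offX : cmd :=
  Then (AddC 2 X offX) (Then (Fetch 3 2) (put_word D off 3)).

(** All three words are copied whatever the tag, which saves a case distinction; after a tag 0 or 1
    [stored_out] does not constrain the other two. *)
Definition put_copy D off X offX alpha : cmd :=
  Then (copy_word D (off + slot alpha) X (offX + slot alpha))
    (Then (copy_word D (off + slot alpha + 1) X (offX + slot alpha + 1))
          (copy_word D (off + slot alpha + 2) X (offX + slot alpha + 2))).

Definition put_sel X offX v (f g : At n -> cmd) alpha : cmd :=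
  Then (AddC 2 X (offX + slot alpha))
    (Then (Fetch 3 2) (IfEq 3 v (f alpha) (g alpha))).

(** One block of code per atom: here [#|At n|] enters the length of the program. *)
Definition row_cmd (f : At n -> cmd) : cmd :=
  foldr (fun alpha c => Then (f alpha) c) Skip (enum (At n)).

Lemma loop_free_row_cmd f :
  (forall alpha, loop_free (f alpha)) -> loop_free (row_cmd f).
Proof.
by rewrite /row_cmd => H; elim: (enum _) => //= alpha l ->; rewrite H.
Qed.

(** Required from every store that differs from [s] only in the scratch registers and the row under
    construction, since the blocks of other atoms may have run already. *)
Definition row_source (f : At n -> cmd) s d rho : Prop :=
  forall alpha s', keeps s s' -> same_but d width (mem s) (mem s') ->
    fills (f alpha) s' (d + slot alpha) (rho alpha).

Lemma wp_row f s d rho : row_source f s d rho ->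
  wp (row_cmd f) s (fun s' => [/\ keeps s s',
     same_but d width (mem s) (mem s') & row_at (mem s') d rho]).
Proof.
move=> H; rewrite /row_cmd.
(* Slots of atoms outside the remaining list [l] are left alone; this protects the output just
   written. *)
suff K l s0 : uniq l -> keeps s s0 -> same_but d width (mem s) (mem s0) ->
    wp (foldr (fun alpha c => Then (f alpha) c) Skip l) s0
     (fun s' => [/\ keeps s s', same_but d width (mem s) (mem s'),
       (forall alpha, alpha \notin l ->
          forall i, i < 3 ->
            mem s' (d + slot alpha + i) = mem s0 (d + slot alpha + i))
       & forall alpha, alpha \in l ->
          stored_out id (mem s') (d + slot alpha) (rho alpha)]).
  apply: wp_impl (K _ _ (enum_uniq _) (keeps_refl s) (fun _ _ => erefl)) _.
  by move=> s' [? ? _ G]; split=> // alpha; apply: G; rewrite mem_enum.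
elim: l s0 => [|alpha l IH] s0 /= Hu Hk Hs.
  by apply: wp_skip; split.
case/andP: Hu => al ul.
apply: wp_then; apply: wp_impl (H alpha s0 Hk Hs) _ => s1 [k1 e1 o1].
have e1' : same_but d width (mem s) (mem s1).
  move=> a Ha; rewrite e1 ?Hs //; have := slot_lt alpha; lia.
apply: wp_impl (IH s1 ul (keeps_trans Hk k1) e1') _ => s2 [k2 e2 n2 o2].
split=> // beta.
- rewrite inE negb_or => /andP[ba bl] i i3; rewrite n2 // e1 //.
  by have := slot_neq ba; lia.
- rewrite inE => /orP[/eqP -> | bl]; last exact: o2.
  by apply: stored_out_same o1; exact: n2.
Qed.

Lemma row_source_const D off v s d : D != 2 -> D != 3 -> reg s D = Num d ->
  row_source (put_const D off v) s (d + off) (fun alpha => inl (v alpha)).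
Proof.
move=> D2 D3 E alpha s' Hk Hs.
apply: wp_then; apply: wp_const; apply: wp_then.
apply: (@wp_addc _ d); first by rewrite /= /upd (negbTE D3) Hk.
apply: wp_store => //=; split.
- by move=> r r2 r3; rewrite /= /upd (negbTE r2) (negbTE r3).
- by move=> a Ha /=; rewrite /upd; case: eqP => //; lia.
- by rewrite /= /upd /= addnA eqxx.
Qed.

Lemma wp_put_word D off r s d Q : D != 2 -> D != 3 -> r != 2 ->
  reg s D = Num d ->
  (forall s', (forall q, q != 2 -> reg s' q = reg s q) ->
     mem s' = upd (mem s) (d + off) (reg s r) -> Q s') ->
  wp (put_word D off r) s Q.
Proof.
move=> D2 D3 r2 E H; apply: wp_then; apply: (wp_addc E); apply: wp_store => //=.
apply: H => /= [q q2|]; first by rewrite /upd (negbTE q2).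
by rewrite /upd (negbTE r2).
Qed.

Lemma row_source_act D off rp rc s d p c :
  [&& D != 2, D != 3, rp != 2, rp != 3, rc != 2 & rc != 3] ->
  reg s D = Num d -> reg s rp = Sym p -> reg s rc = Num c ->
  row_source (put_act D off rp rc) s (d + off) (fun=> inr (p, c)).
Proof.
move=> /and5P[D2 D3 p2 p3 /andP[c2 c3]] E Ep Ec alpha s' Hk Hs.
apply: wp_then; apply: wp_const.
apply: wp_then; apply: (wp_put_word (d := d)) => //.
  by rewrite /= /upd (negbTE D3) Hk.
move=> s1 k1 m1; apply: wp_then; apply: (wp_put_word (d := d)) => //.
  by rewrite k1 //= /upd (negbTE D3) Hk.
move=> s2 k2 m2; apply: (wp_put_word (d := d)) => //.
  by rewrite k2 // k1 //= /upd (negbTE D3) Hk.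
move=> s3 k3 m3.
have e1 : reg s1 rp = Sym p by rewrite k1 //= /upd (negbTE p3) Hk.
have e2 : reg s2 rc = Num c by rewrite k2 // k1 //= /upd (negbTE c3) Hk.
split.
- by move=> r r2 r3; rewrite k3 // k2 // k1 //= /upd (negbTE r3).
- move=> a Ha; rewrite m3 m2 m1 /upd /=.
  by case: eqP => [|_]; [lia | case: eqP => [|_]; [lia | case: eqP => // ?; lia]].
- rewrite /= m3 m2 m1 e1 e2 /upd /=; split.
  + by case: eqP => [|_]; [lia | case: eqP => [|_]; [lia | case: eqP => // ?; lia]].
  + by case: eqP => [|_]; [lia | case: eqP => // ?; lia].
  + by case: eqP => // ?; lia.
Qed.

Lemma wp_copy_word D off X offX s d x Q : D != 2 -> D != 3 ->
  reg s D = Num d -> reg s X = Num x ->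
  (forall s', keeps s s' ->
     mem s' = upd (mem s) (d + off) (mem s (x + offX)) -> Q s') ->
  wp (copy_word D off X offX) s Q.
Proof.
move=> D2 D3 E Ex H; apply: wp_then; apply: (wp_addc Ex).
apply: wp_then; apply: wp_fetch => //=.
apply: (wp_put_word (d := d)) => //.
  by rewrite /= /upd (negbTE D3) (negbTE D2).
move=> s' k m; apply: H => // r r2 r3.
by rewrite k //= /upd (negbTE r3) (negbTE r2).
Qed.

Lemma row_source_copy D off X offX s d x rho :
  [&& D != 2, D != 3, X != 2 & X != 3] ->
  reg s D = Num d -> reg s X = Num x -> row_at (mem s) (x + offX) rho ->
  (x + offX + width <= d + off) || (d + off + width <= x + offX) ->
  row_source (put_copy D off X offX) s (d + off) rho.
Proof.
move=> /and4P[D2 D3 X2 X3] E Ex H dis alpha s' Hk Hs.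
apply: wp_then; apply: (wp_copy_word (d := d) (x := x)); rewrite ?Hk //.
move=> s1 k1 m1; apply: wp_then.
apply: (wp_copy_word (d := d) (x := x)); rewrite ?k1 ?Hk //.
move=> s2 k2 m2.
apply: (wp_copy_word (d := d) (x := x)); rewrite ?k2 ?k1 ?Hk //.
move=> s3 k3 m3; split.
- exact: keeps_trans (keeps_trans k1 k2) k3.
- move=> a Ha; rewrite m3 m2 m1 /upd /=.
  by case: eqP => [|_]; [lia | case: eqP => [|_]; [lia | case: eqP => // ?; lia]].
- have W := slot_lt alpha.
  apply: stored_out_same (H alpha) => i i3.
  have src q : q < 3 -> mem s' (x + (offX + slot alpha + q)) =
      mem s (x + offX + slot alpha + q).
    by move=> q3; rewrite (_ : _ + _ = x + offX + slot alpha + q) ?Hs //; lia.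
  have s0 := src 0 isT; have s1' := src 1 isT; have s2' := src 2 isT.
  rewrite !addn0 in s0.
  rewrite m3 m2 m1 /upd.
  have [-> | [-> | ->]] : i = 0 \/ i = 1 \/ i = 2 by lia.
  + case: eqP => [|_]; first lia; case: eqP => [|_]; first lia.
    by case: eqP => [_|]; last lia; rewrite s0 addn0.
  + case: eqP => [|_]; first lia; case: eqP => [_|]; last lia.
    by case: eqP => [|_]; first lia; rewrite s1'.
  + case: eqP => [_|]; last lia; case: eqP => [|_]; first lia.
    by case: eqP => [|_]; first lia; rewrite s2'.
Qed.

Lemma row_source_sel X offX v f g s d x rho rho1 rho2 :
  X != 2 -> X != 3 -> reg s X = Num x -> row_at (mem s) (x + offX) rho ->
  (x + offX + width <= d) || (d + width <= x + offX) ->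
  row_source f s d rho1 -> row_source g s d rho2 ->
  row_source (put_sel X offX v f g) s d
    (fun alpha => if out_tag (rho alpha) == v then rho1 alpha else rho2 alpha).
Proof.
move=> X2 X3 E H dis Hf Hg alpha s' Hk Hs.
apply: wp_then; apply: (wp_addc (m := x)); first by rewrite Hk.
apply: wp_then; apply: wp_fetch => //=; apply: wp_ifeq.
  rewrite /= addnA Hs; first exact: (stored_out_tag (H alpha)).
  by have := slot_lt alpha; lia.
set s1 := set_reg _ _ _.
have k1 : keeps s' s1.
  by move=> r r2 r3; rewrite /= /upd (negbTE r2) (negbTE r3).
have k : keeps s s1 by exact: keeps_trans k1.
case: (out_tag _ == v); [have := Hf alpha s1 k Hs | have := Hg alpha s1 k Hs];
  move/wp_impl; apply=> s2 [k2 m2 o2]; split=> //; exact: keeps_trans k1 k2.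
Qed.

End Rows.

(** * Predicates along consecutive token positions *)

Section Segments.
Variable T : Type.

Fixpoint seg (P : nat -> T -> Prop) j (l : seq T) : Prop :=
  if l is x :: l' then P j x /\ seg P j.+1 l' else True.

Lemma seg_cat P j l l' :
  seg P j (l ++ l') <-> seg P j l /\ seg P (j + size l) l'.
Proof.
elim: l j => [|x l IH] j /=; first by rewrite addn0; split=> [|[]].
by rewrite IH addnS; split=> [[? [? ?]]|[[? ?] ?]].
Qed.

Lemma seg_impl (P Q : nat -> T -> Prop) j l :
  (forall i x, j <= i < j + size l -> P i x -> Q i x) -> seg P j l -> seg Q j l.
Proof.
elim: l j => //= x l IH j H [Px Pl]; split; first by apply: H Px; lia.
by apply: IH Pl => i y Hi; apply: H; lia.
Qed.

End Segments.

(** * State numbers and the algebra of rows *)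

Section Numbering.
Variables (n : nat) (Sigma : Type).
Implicit Types (b : bexp n) (e f g : exp n Sigma).

(** Action occurrences are numbered from left to right starting at [c], the order in which the first
    pass meets them. *)
Fixpoint state_num e : nat -> pc_state (thompson e) -> nat :=
  match e return nat -> pc_state (thompson e) -> nat with
  | Do _ => fun c _ => c
  | Test _ => fun c _ => c
  | Seq f g => fun c (z : (pc_state (thompson f) + pc_state (thompson g))%type) =>
      match z with
      | inl x => state_num c x
      | inr y => state_num (c + nact f) y
      end
  | Cond _ f g => fun c (z : (pc_state (thompson f) + pc_state (thompson g))%type) =>
      match z with
      | inl x => state_num c x
      | inr y => state_num (c + nact f) y
      end
  | Loop _ f => fun c x => @state_num f c x
  end.

Lemma card_thompson e : #|pc_state (thompson e)| = nact e.
Proof.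
elim: e => [p|b|f IHf g IHg|b f IHf g IHg|b f IHf] /=.
- by rewrite card_unit.
- by rewrite card_void.
- by rewrite card_sum IHf IHg.
- by rewrite card_sum IHf IHg.
- by [].
Qed.

Lemma state_num_range e c (x : pc_state (thompson e)) :
  c <= state_num c x < c + nact e.
Proof.
elim: e c x => [p|b|f IHf g IHg|b f IHf g IHg|b f IHf] c //=.
- by move=> _; rewrite addn1 leqnn ltnSn.
- by case=> x; [have := IHf c x | have := IHg (c + nact f) x]; lia.
- by case=> x; [have := IHf c x | have := IHg (c + nact f) x]; lia.
Qed.

Lemma state_num_inj e c : injective (@state_num e c).
Proof.
have R := state_num_range.
elim: e c => [p|b|f IHf g IHg|b f IHf g IHg|b f IHf] c //=.
- by move=> x y _; case: (x : unit) (y : unit) => [] [].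
- case=> x [] y E.
  + by rewrite (IHf _ _ _ E).
  + by have := R _ c x; have := R _ (c + nact f) y; lia.
  + by have := R _ (c + nact f) x; have := R _ c y; lia.
  + by rewrite (IHg _ _ _ E).
- case=> x [] y E.
  + by rewrite (IHf _ _ _ E).
  + by have := R _ c x; have := R _ (c + nact f) y; lia.
  + by have := R _ (c + nact f) x; have := R _ c y; lia.
  + by rewrite (IHg _ _ _ E).
Qed.

Definition iota_row e c : GF n Sigma nat :=
  gmap (@state_num e c) (@pc_iota _ _ (thompson e)).

Definition delta_row e c (x : pc_state (thompson e)) : GF n Sigma nat :=
  gmap (@state_num e c) (pc_delta x).

Definition test_row b : GF n Sigma nat :=
  fun alpha => inl (boolp.asbool (atom_le alpha b)).

Definition then_row (h k : GF n Sigma nat) : GF n Sigma nat :=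
  fun alpha => if out_tag (h alpha) == 1 then k alpha else h alpha.

Lemma iota_row_seq f g c :
  iota_row (Seq f g) c =1 then_row (iota_row f c) (iota_row g (c + nact f)).
Proof.
move=> alpha; rewrite /iota_row /then_row /gmap /= /gmap.
by case: (pc_iota (thompson f) alpha) => [[]|[]] //=;
   case: (pc_iota (thompson g) alpha) => [[]|[]].
Qed.

Lemma iota_row_cond b f g c alpha :
  iota_row (Cond b f g) c alpha =
  if beval alpha b then iota_row f c alpha else iota_row g (c + nact f) alpha.
Proof.
rewrite /iota_row /gmap /= atom_leE; case: (beval alpha b) => /=.
  by rewrite /gmap; case: (pc_iota (thompson f) alpha) => [[]|[]].
by rewrite /gmap; case: (pc_iota (thompson g) alpha) => [[]|[]].
Qed.

Lemma iota_row_loop b f c alpha :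
  iota_row (Loop b f) c alpha =
  if beval alpha b then
    if out_tag (iota_row f c alpha) == 1 then inl false else iota_row f c alpha
  else inl true.
Proof.
rewrite /iota_row /gmap /= /loop_iota atom_leE /=.
by case: (beval alpha b) => //=; case: (pc_iota (thompson f) alpha) => [[]|[]].
Qed.

(** Associativity of |>: the left operand is continued by iota_g, and the result by [k]. *)
Lemma delta_row_seql f g c k (x : pc_state (thompson f)) :
  then_row (@delta_row (Seq f g) c (inl x)) k =1
  then_row (delta_row c x) (then_row (iota_row g (c + nact f)) k).
Proof.
move=> alpha; rewrite /delta_row /iota_row /then_row /gmap /= /unif_cont /=.
rewrite /gmap; case: (pc_delta x alpha) => [[]|[]] //=.
by case: (pc_iota (thompson g) alpha) => [[]|[]].
Qed.

Lemma delta_row_seqr f g c (y : pc_state (thompson g)) :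
  @delta_row (Seq f g) c (inr y) =1 delta_row (c + nact f) y.
Proof.
move=> alpha; rewrite /delta_row /gmap /= /unif_cont /= /gmap.
by case: (pc_delta y alpha) => [[]|[]].
Qed.

Lemma delta_row_condl b f g c (x : pc_state (thompson f)) :
  @delta_row (Cond b f g) c (inl x) =1 delta_row c x.
Proof.
move=> alpha; rewrite /delta_row /gmap /= /gmap.
by case: (pc_delta x alpha) => [[]|[]].
Qed.

Lemma delta_row_condr b f g c (y : pc_state (thompson g)) :
  @delta_row (Cond b f g) c (inr y) =1 delta_row (c + nact f) y.
Proof.
move=> alpha; rewrite /delta_row /gmap /= /gmap.
by case: (pc_delta y alpha) => [[]|[]].
Qed.

(** Associativity again. The inner continuation is the initial row of the loop itself, which depends
    only on [b] and the initial row of [f], so no fixed point has to be computed. *)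
Lemma delta_row_loop b f c k (x : pc_state (thompson f)) :
  then_row (@delta_row (Loop b f) c x) k =1
  then_row (delta_row c x) (then_row (iota_row (Loop b f) c) k).
Proof.
move=> alpha; rewrite /delta_row /iota_row /then_row /gmap /= /unif_cont /=.
by case: (pc_delta x alpha) => [[]|[]] //=;
  case: (loop_iota _ _ alpha) => [[]|[]].
Qed.

Lemma size_btokens b : size (btokens Sigma b) = bsize b.
Proof. by elim: b => //= [b IHb c IHc|b IHb c IHc|b IHb];
  rewrite !size_cat /= ?IHb ?IHc; lia. Qed.

Lemma size_tokens e : size (tokens e) = esize e.
Proof.
elim: e => [p|b|f IHf g IHg|b f IHf g IHg|b f IHf] //=;
  rewrite ?size_cat /= ?size_btokens ?IHf ?IHg; lia.
Qed.

Lemma nact_le_esize e : nact e <= esize e.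
Proof. by elim: e => [p|b|f IHf g IHg|b f IHf g IHg|b f IHf] //=; lia. Qed.

Fixpoint bframes b j : seq (nat * GF n Sigma nat) :=
  match b with
  | BAnd b1 b2 | BOr b1 b2 => bframes b1 j ++ bframes b2 (j + bsize b1)
  | BNot b1 => bframes b1 j
  | _ => [::]
  end ++ [:: (j, test_row b)].

(** The intended frames in token order, each with the first token and the initial row of the
    subexpression rooted there. [Test b] adds none because the root token of [b] already stands for
    it. *)
Fixpoint frames e j c : seq (nat * GF n Sigma nat) :=
  match e with
  | Do _ => [::]
  | Test b => bframes b j
  | Seq f g => frames f j c ++ frames g (j + esize f) (c + nact f)
  | Cond b f g => bframes b j ++ frames f (j + bsize b) c
      ++ frames g (j + bsize b + esize f) (c + nact f)
  | Loop b f => bframes b j ++ frames f (j + bsize b) c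
  end ++ (if e is Test _ then [::] else [:: (j, iota_row e c)]).

Lemma size_bframes b j : size (bframes b j) = bsize b.
Proof. by elim: b j => //= [b IHb c IHc|b IHb c IHc|b IHb] j;
  rewrite !size_cat /= ?IHb ?IHc; lia. Qed.

Lemma size_frames e j c : size (frames e j c) = esize e.
Proof.
elim: e j c => [p|b|f IHf g IHg|b f IHf g IHg|b f IHf] j c //=;
  rewrite !size_cat /= ?size_cat ?size_bframes ?IHf ?IHg; lia.
Qed.

End Numbering.

(** * Code of the first pass: initial rows *)

Section Programs.
Variable n : nat.

(* Memory holds the input, from T0 on the table, and from B on one frame per  *)
(* token.  The words of the frame of token j, the root of a subexpression e,  *)
(* are: the address of the frame of the first token of e, which yields the    *)
(* left siblings of e; the row iota_e; and the row of the continuation of e.  *)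
(* Registers: 0 tokens left, 1 next state number, 4 and 5 the addresses of    *)
(* the current token and frame, 6 the table entry, 7, 8 and 9 the frames of   *)
(* the last, the last but one and the first of three operands, 10 the first   *)
(* word of the frame visited last, 11 and 12 the token, 13 the number of      *)
(* tokens, 14 the root frame of the input.                                    *)
Definition fsize : nat := 1 + 2 * width n.

(** When the frame before [Y] is the root of an operand, register 10 receives the first frame of
    that operand, and the frame before that one is the root of its left neighbour. Iteration visits
    the operands from right to left. *)
Definition descend X Y : cmd := Then (SubC X Y fsize) (Fetch 10 X).

(** [R] holds the first frame of the subexpression: the current frame for a leaf, otherwise what the
    last [descend] left in register 10. *)
Definition finish (f : At n -> cmd) R : cmd := Then (row_cmd f) (Store 5 R).

Definition leaf f : cmd := finish f 5.
Definition node1 f : cmd := Then (descend 7 5) (finish f 10).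
Definition node2 f : cmd :=
  Then (descend 7 5) (Then (descend 8 10) (finish f 10)).
Definition node3 f : cmd :=
  Then (descend 7 5) (Then (descend 8 10) (Then (descend 9 10) (finish f 10))).

Definition test_bit (i : nat) : At n -> bool :=
  fun alpha => if insub i is Some o then alpha o else false.

Definition iota_const v : At n -> cmd := put_const 5 1 (fun=> v).
Definition iota_copy X : At n -> cmd := put_copy 5 1 X 1.

(** Operators select according to acceptance of their first operand. Tags 3 and 7 share their code
    because conjunction of tests is sequential composition. *)
Definition iota_code (tag : nat) : cmd :=
  match tag with
  | 0 => leaf (iota_const false)
  | 1 => leaf (iota_const true)
  | 2 => switch 12 (fun i => leaf (put_const 5 1 (test_bit i))) n
  | 3 | 7 => node2 (put_sel 8 1 1 (iota_copy 7) (iota_copy 8))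
  | 4 => node2 (put_sel 8 1 1 (iota_const true) (iota_copy 7))
  | 5 => node1 (put_sel 7 1 1 (iota_const false) (iota_const true))
  | 6 => Then (leaf (put_act 5 1 12 1)) (Then (AddC 1 1 1) (AddC 6 6 (width n)))
  | 8 => node3 (put_sel 9 1 1 (iota_copy 8) (iota_copy 7))
  | 9 => node2 (put_sel 8 1 1
           (put_sel 7 1 1 (iota_const false) (iota_copy 7)) (iota_const true))
  | _ => Skip
  end.

Definition iota_body : cmd :=
  Then (Fetch 11 4) (Then (AddC 4 4 1) (Then (Fetch 12 4) (Then (AddC 4 4 1)
    (Then (switch 11 iota_code 10) (Then (AddC 5 5 fsize) (SubC 0 0 1)))))).

Definition iota_cost : nat := (max_steps iota_body).+1.

Lemma loop_free_iota_body : loop_free iota_body.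
Proof.
by rewrite /= ?loop_free_row_cmd ?loop_free_switch //= => i;
  rewrite /= ?loop_free_row_cmd.
Qed.

End Programs.

(** * Correctness of the first pass *)

Section IotaPass.
Variables (n : nat) (Sigma : Type) (T0 B : nat).
Implicit Types (s : store Sigma) (m : nat -> word Sigma).
Implicit Types (rho : GF n Sigma nat) (b : bexp n) (e : exp n Sigma).
Local Notation frame := (nat * GF n Sigma nat)%type.
Local Notation rows := (nat -> GF n Sigma nat).
Local Notation width := (width n).
Local Notation fsize := (fsize n).

Definition faddr j : nat := B + fsize * j.

Lemma faddrS j : faddr j.+1 = faddr j + fsize.
Proof. by rewrite /faddr mulnS; lia. Qed.

Lemma faddr_lt i j : i < j -> faddr i + fsize <= faddr j.
Proof. by rewrite -faddrS /faddr leq_add2l leq_mul2l orbC => ->. Qed.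

Lemma faddr_ge j : B <= faddr j. Proof. exact: leq_addr. Qed.

Definition frame_at m j (fr : frame) : Prop :=
  m (faddr j) = Num (faddr fr.1) /\ row_at m (faddr j + 1) fr.2.

Definition token_at m j (tok : nat * word Sigma) : Prop :=
  m (2 * j) = Num tok.1 /\ m (2 * j + 1) = tok.2.

Definition same_below hi m m' : Prop := forall a, a < hi -> m' a = m a.

Lemma frame_at_same_below m m' i j fr :
  i < j -> same_below (faddr j) m m' -> frame_at m i fr -> frame_at m' i fr.
Proof.
move=> /faddr_lt; rewrite {1}/fsize => ij E [H H'].
split; first by rewrite E //; lia.
by apply: row_at_same H' => k kw; apply: E; lia.
Qed.

Definition regs_at s q j t : Prop :=
  [/\ reg s 0 = Num q, reg s 4 = Num (2 * j), reg s 5 = Num (faddr j)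
    & reg s 6 = Num (T0 + width * t)].

Definition node_post s j c (fr : frame) s' : Prop :=
  [/\ forall r, r \in [:: 0; 4; 5; 13] -> reg s' r = reg s r,
      reg s' 1 = Num c, reg s' 6 = Num (T0 + width * c),
      same_below (faddr j) (mem s) (mem s') & frame_at (mem s') j fr].

Definition node_pre s j c (w : word Sigma) : Prop :=
  [/\ reg s 1 = Num c, reg s 5 = Num (faddr j), reg s 6 = Num (T0 + width * c)
    & reg s 12 = w].

Lemma iota_step s q j c tok c' fr :
  regs_at s q.+1 j c -> reg s 1 = Num c -> token_at (mem s) j tok ->
  tok.1 < 10 ->
  (forall s', mem s' = mem s -> node_pre s' j c tok.2 ->
     wp (iota_code n tok.1) s' (node_post s' j c' fr)) ->
  exists2 s', leads (iota_body n) s (iota_cost n) s' &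
    [/\ regs_at s' q j.+1 c', reg s' 1 = Num c', reg s' 13 = reg s 13,
        same_below (faddr j) (mem s) (mem s') & frame_at (mem s') j fr].
Proof.
move=> [r0 r4 r5 r6] r1 [t1 t2] lt10 H.
apply: (leads_step _ r0); first exact: loop_free_iota_body.
apply: wp_then; apply: (wp_fetch r4).
apply: wp_then; apply: (wp_addc (m := 2 * j)) => //.
apply: wp_then; apply: (wp_fetch (a := 2 * j + 1)) => //.
apply: wp_then; apply: (wp_addc (m := 2 * j + 1)) => //.
apply: wp_then; apply: (wp_switch (i := tok.1) _ lt10); first exact: t1.
apply: wp_impl.
  by apply: H => //; split.
move=> s' [k k1 k6 e fr'].
apply: wp_then; apply: (wp_addc (m := faddr j)); first by rewrite k.
apply: (wp_subc (m := q.+1)); first by rewrite /= /upd /= k.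
split; rewrite //= /upd //= ?k //.
split; rewrite //= /upd /= ?k //= /upd /=.
- by rewrite subn1.
- by congr Num; lia.
- by rewrite faddrS.
Qed.

(** Uniform in the position [j], the next state number [c] and the [q] tokens still to come. Nothing
    below [faddr j] changes, so the frames of earlier operands survive. *)
Definition builds ts (ann : nat -> nat -> seq frame) k : Prop :=
  forall s q j c, regs_at s (size ts + q) j c -> reg s 1 = Num c ->
  seg (token_at (mem s)) j ts -> 2 * (j + size ts) <= B ->
  exists2 s', leads (iota_body n) s (iota_cost n * size ts) s' &
    [/\ regs_at s' q (j + size ts) (c + k), reg s' 1 = Num (c + k),
        reg s' 13 = reg s 13, same_below (faddr j) (mem s) (mem s')
      & seg (frame_at (mem s')) j (ann j c)].

Lemma token_at_same_below m m' i hi tok : 2 * i.+1 <= hi ->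
  same_below hi m m' -> token_at m i tok -> token_at m' i tok.
Proof. by move=> Hi E [H H']; split; rewrite E //; lia. Qed.

Lemma builds_nil : builds [::] (fun _ _ => [::]) 0.
Proof.
move=> s q j c H H1 _ _; exists s; first by rewrite muln0; exact: leads_refl.
by rewrite /= !addn0.
Qed.

Lemma builds_cat ts ts' ann ann' k k' :
  (forall j c, size (ann j c) = size ts) ->
  builds ts ann k -> builds ts' ann' k' ->
  builds (ts ++ ts')
    (fun j c => ann j c ++ ann' (j + size ts) (c + k)) (k + k').
Proof.
move=> Hsz H H' s q j c Hr H1; rewrite size_cat => /seg_cat[Ht Ht'] le.
rewrite size_cat -addnA in Hr.
case: (H _ _ _ _ Hr H1 Ht) => [|s1 L1 [R1 C1 N1 E1 F1]]; first lia.
case: (H' s1 q (j + size ts) (c + k) R1 C1) => [||s2 L2 [R2 C2 N2 E2 F2]].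
- apply: seg_impl Ht' => i x Hi; apply: token_at_same_below E1.
  by have := faddr_ge j; lia.
- lia.
exists s2; first by rewrite mulnDr; exact: leads_trans L1 L2.
rewrite !addnA; split=> //; first by rewrite N2.
- move=> a Ha; rewrite E2 ?E1 //; move: Ha; rewrite /faddr.
  by rewrite mulnDr; lia.
- apply/seg_cat; rewrite Hsz; split=> //.
  apply: seg_impl F1 => i x Hi; apply: frame_at_same_below E2.
  by rewrite -(Hsz j c); lia.
Qed.

(** The inductive step for postfix notation: when an operator is read, the frames of its operands
    lie complete and contiguous just below its own. *)
Lemma builds_snoc ts ann k k' tok (rho : rows) :
  (forall j c, size (ann j c) = size ts) ->
  tok.1 < 10 -> builds ts ann k ->
  (forall s j c r, r = j + size ts -> seg (frame_at (mem s)) j (ann j c) ->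
     node_pre s r (c + k) tok.2 ->
     wp (iota_code n tok.1) s (node_post s r (c + k') (j, rho c))) ->
  builds (ts ++ [:: tok]) (fun j c => ann j c ++ [:: (j, rho c)]) k'.
Proof.
move=> Hsz lt10 H H' s q j c Hr H1; rewrite size_cat => /seg_cat[Ht [Ht' _]] le.
rewrite size_cat -addnA in Hr; rewrite /= in le.
case: (H _ _ _ _ Hr H1 Ht) => [|s1 L1 [R1 C1 N1 E1 F1]]; first lia.
case: (iota_step (c' := c + k') (fr := (j, rho c)) R1 C1 _ lt10)
  => [|s' e' Hn|s2 L2 [R2 C2 N2 E2 F2]].
- by apply: token_at_same_below E1 Ht'; have := faddr_ge j; lia.
- by apply: H' Hn => //; rewrite e'.
exists s2; first by rewrite mulnDr muln1; exact: leads_trans L1 L2.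
rewrite /= addn1 addnS; split=> //; first by rewrite N2.
- move=> a Ha; rewrite E2 ?E1 //; move: Ha; rewrite /faddr.
  by rewrite mulnDr; lia.
- apply/seg_cat; rewrite Hsz; split; last by [].
  apply: seg_impl F1 => i x Hi; apply: frame_at_same_below E2.
  by rewrite -(Hsz j c); lia.
Qed.

Lemma builds_ext ts ann ann' k :
  (forall j c, ann j c = ann' j c) -> builds ts ann k -> builds ts ann' k.
Proof.
move=> E H s q j c Hr H1 Ht le; case: (H s q j c Hr H1 Ht le) => s' L R.
by exists s'; rewrite -?E.
Qed.

Lemma wp_descend X Y s r fr Q : X != 10 ->
  reg s Y = Num (faddr r.+1) -> frame_at (mem s) r fr ->
  (forall s', reg s' X = Num (faddr r) -> reg s' 10 = Num (faddr fr.1) ->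
     mem s' = mem s -> (forall q, q != X -> q != 10 -> reg s' q = reg s q) ->
     Q s') ->
  wp (descend n X Y) s Q.
Proof.
move=> X10 E [F _] H; apply: wp_then; apply: (wp_subc E).
rewrite faddrS addnK; apply: (wp_fetch (a := faddr r)).
  by rewrite /= /upd eqxx.
apply: H => //=; rewrite /upd ?eqxx ?(negbTE X10) // => q qX q10.
by rewrite (negbTE qX) (negbTE q10).
Qed.

Lemma wp_finish f R s j i c rho :
  R != 2 -> R != 3 ->
  reg s 5 = Num (faddr j) -> reg s R = Num (faddr i) ->
  reg s 1 = Num c -> reg s 6 = Num (T0 + width * c) ->
  row_source f s (faddr j + 1) rho ->
  wp (finish f R) s (node_post s j c (i, rho)).
Proof.
move=> R2 R3 E5 ER E1 E6 H; apply: wp_then.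
apply: wp_impl (wp_row H) _ => s1 [k e o].
apply: (wp_store (a := faddr j)); first by rewrite k.
split=> //=.
- by move=> r; rewrite !inE => /or4P[] /eqP ->; rewrite k.
- by rewrite k.
- by rewrite k.
- by move=> a Ha; rewrite /= /upd; case: eqP => [|_]; [lia | rewrite e //; lia].
- split=> /=; first by rewrite /upd eqxx k.
  by apply: row_at_same o => a _; rewrite /upd; case: eqP => //; lia.
Qed.

Lemma node_post_trans s s' j c fr u :
  (forall q, q \notin [:: 7; 8; 9; 10] -> reg s' q = reg s q) ->
  mem s' = mem s -> node_post s' j c fr u -> node_post s j c fr u.
Proof.
move=> k e [k' E1 E6 b F]; split=> //; last by rewrite -e.
by move=> r Hr; rewrite k' // k //; move: Hr; rewrite !inE => /or4P[] /eqP ->.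
Qed.

Lemma row_source_iota_const v s j :
  reg s 5 = Num (faddr j) ->
  row_source (@iota_const n v) s (faddr j + 1) (fun=> inl v).
Proof. exact: row_source_const. Qed.

Lemma row_source_iota_copy X s j r rho :
  X != 2 -> X != 3 -> reg s 5 = Num (faddr j) -> reg s X = Num (faddr r) ->
  r < j -> row_at (mem s) (faddr r + 1) rho ->
  row_source (@iota_copy n X) s (faddr j + 1) rho.
Proof.
move=> X2 X3 E5 EX /faddr_lt rj H.
apply: row_source_copy E5 EX H _; first by rewrite X2 X3.
by move: rj; rewrite {1}/fsize; lia.
Qed.

Lemma row_source_iota_sel X v f g s j r rho rho1 rho2 :
  X != 2 -> X != 3 -> reg s X = Num (faddr r) ->
  r < j -> row_at (mem s) (faddr r + 1) rho ->
  row_source f s (faddr j + 1) rho1 -> row_source g s (faddr j + 1) rho2 ->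
  row_source (put_sel X 1 v f g) s (faddr j + 1)
    (fun alpha => if out_tag (rho alpha) == v then rho1 alpha else rho2 alpha).
Proof.
move=> X2 X3 EX /faddr_lt rj H; apply: row_source_sel EX H _ => //.
by move: rj; rewrite {1}/fsize; lia.
Qed.

Lemma wp_leaf f s j c w rho : node_pre s j c w ->
  row_source f s (faddr j + 1) rho ->
  wp (leaf f) s (node_post s j c (j, rho)).
Proof. by move=> [E1 E5 E6 _] H; apply: wp_finish => //; right. Qed.

Lemma wp_node1 f s c r w i rho1 rho : node_pre s r.+1 c w ->
  frame_at (mem s) r (i, rho1) ->
  (forall s', reg s' 5 = Num (faddr r.+1) -> reg s' 7 = Num (faddr r) ->
     row_at (mem s') (faddr r + 1) rho1 ->
     row_source f s' (faddr r.+1 + 1) rho) ->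
  wp (node1 f) s (node_post s r.+1 c (i, rho)).
Proof.
move=> [E1 E5 E6 _] F H; apply: wp_then.
apply: (wp_descend _ E5 F) => // s1 R7 R10 e1 k1.
apply: wp_impl.
  apply: (@wp_finish f 10 s1 r.+1 i c rho); rewrite // ?k1 //.
  by apply: H; rewrite // ?k1 // e1; case: F.
move=> s2; apply: node_post_trans => // q; rewrite !inE !negb_or.
by case/and4P => *; rewrite k1.
Qed.

(** The right operand has root [r] and first token [r2.+1], so [r2] is the root of the left operand,
    whose first token [i] is that of the whole. *)
Lemma wp_node2 f s c r r2 w i rho1 rho2 rho : node_pre s r.+1 c w ->
  frame_at (mem s) r (r2.+1, rho1) -> frame_at (mem s) r2 (i, rho2) ->
  (forall s', reg s' 5 = Num (faddr r.+1) -> reg s' 7 = Num (faddr r) ->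
     reg s' 8 = Num (faddr r2) ->
     row_at (mem s') (faddr r + 1) rho1 -> row_at (mem s') (faddr r2 + 1) rho2 ->
     row_source f s' (faddr r.+1 + 1) rho) ->
  wp (node2 f) s (node_post s r.+1 c (i, rho)).
Proof.
move=> [E1 E5 E6 _] F F2 H; apply: wp_then.
apply: (wp_descend _ E5 F) => // s1 R7 R10 e1 k1; apply: wp_then.
rewrite -e1 in F2; apply: (wp_descend _ R10 F2) => // s2 R8 R10' e2 k2.
apply: wp_impl.
  apply: (@wp_finish f 10 s2 r.+1 i c rho); rewrite // ?k2 // ?k1 //.
  by apply: H; rewrite // ?k2 // ?k1 // e2; [rewrite e1; case: F | case: F2].
move=> s3; apply: node_post_trans; last by rewrite e2.
by move=> q; rewrite !inE !negb_or => /and4P[*]; rewrite k2 ?k1.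
Qed.

Lemma wp_node3 f s c r r2 r3 w i rho1 rho2 rho3 rho : node_pre s r.+1 c w ->
  frame_at (mem s) r (r2.+1, rho1) -> frame_at (mem s) r2 (r3.+1, rho2) ->
  frame_at (mem s) r3 (i, rho3) ->
  (forall s', reg s' 5 = Num (faddr r.+1) -> reg s' 7 = Num (faddr r) ->
     reg s' 8 = Num (faddr r2) -> reg s' 9 = Num (faddr r3) ->
     row_at (mem s') (faddr r + 1) rho1 -> row_at (mem s') (faddr r2 + 1) rho2 ->
     row_at (mem s') (faddr r3 + 1) rho3 ->
     row_source f s' (faddr r.+1 + 1) rho) ->
  wp (node3 f) s (node_post s r.+1 c (i, rho)).
Proof.
move=> [E1 E5 E6 _] F F2 F3 H; apply: wp_then.
apply: (wp_descend _ E5 F) => // s1 R7 R10 e1 k1; apply: wp_then.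
rewrite -e1 in F2; apply: (wp_descend _ R10 F2) => // s2 R8 R10' e2 k2.
apply: wp_then; rewrite -e1 -e2 in F3.
apply: (wp_descend _ R10' F3) => // s3 R9 R10'' e3 k3.
apply: wp_impl.
  apply: (@wp_finish f 10 s3 r.+1 i c rho); rewrite // ?k3 // ?k2 // ?k1 //.
  apply: H; rewrite // ?k3 // ?k2 // ?k1 // e3.
  - by rewrite e2 e1; case: F.
  - by rewrite e2; case: F2.
  - by case: F3.
move=> s4; apply: node_post_trans; last by rewrite e3 e2.
by move=> q; rewrite !inE !negb_or => /and4P[*]; rewrite k3 ?k2 ?k1.
Qed.

Lemma row_source_ext f s d rho rho' :
  rho =1 rho' -> row_source f s d rho -> row_source f s d rho'.
Proof. by move=> E H alpha; rewrite -E; exact: H. Qed.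

Definition rooted j rho (l : seq frame) : Prop :=
  exists l', l = l' ++ [:: (j, rho)].

Lemma rooted_cons l j rho : rooted j rho (l ++ [:: (j, rho)]).
Proof. by exists l. Qed.

Lemma rooted_size l j rho : rooted j rho l -> 0 < size l.
Proof. by case=> l' ->; rewrite size_cat addn1. Qed.

Lemma rooted_frame m l j k rho : rooted j rho l -> seg (frame_at m) k l ->
  frame_at m (k + size l).-1 (j, rho).
Proof.
by case=> l' -> /seg_cat[_ [H _]]; rewrite size_cat /= addn1 addnS.
Qed.

(* [ts] compiles to the frames [ann j c], the last of which holds [rho c],    *)
(* when it starts at token j and c states have been numbered before.          *)
Definition compiles ts (ann : nat -> nat -> seq frame) k
    (rho : rows) : Prop :=
  [/\ builds ts ann k, forall j c, size (ann j c) = size ts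
    & forall j c, rooted j (rho c) (ann j c)].

Lemma compiles_leaf tok k (rho : rows) :
  tok.1 < 10 ->
  (forall s j c, node_pre s j c tok.2 ->
     wp (iota_code n tok.1) s (node_post s j (c + k) (j, rho c))) ->
  compiles [:: tok] (fun j c => [:: (j, rho c)]) k rho.
Proof.
move=> lt10 H; split=> // [|j c]; last by exists [::].
apply: (builds_snoc (rho := rho) _ lt10 builds_nil) => // s j c r.
by rewrite addn0 => -> _; rewrite addn0; exact: H.
Qed.

Lemma compiles_node1 ts ann k (rho1 : rows) tok f (rho : rows) :
  compiles ts ann k rho1 -> tok.1 < 10 -> iota_code n tok.1 = node1 f ->
  (forall s r c, reg s 5 = Num (faddr r.+1) -> reg s 7 = Num (faddr r) ->
     row_at (mem s) (faddr r + 1) (rho1 c) ->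
     row_source f s (faddr r.+1 + 1) (rho c)) ->
  compiles (ts ++ [:: tok]) (fun j c => ann j c ++ [:: (j, rho c)]) k rho.
Proof.
move=> [Hb Hs Hr] lt10 Ef H; split=> [|j c|j c]; last exact: rooted_cons.
  apply: (builds_snoc Hs lt10 Hb) => s j c r Er F N.
  have := rooted_frame (Hr j c) F; have := rooted_size (Hr j c).
  rewrite Hs -Er Ef => pos; case: r Er N => [|r] Er N; first lia.
  by move=> F1; apply: (wp_node1 N F1) => s' E5 E7 A; apply: H E5 E7 A.
by rewrite !size_cat Hs.
Qed.

Lemma compiles_node2 ts1 ann1 k1 (rho1 : rows) ts2 ann2 k2 (rho2 : rows)
    tok f (rho : rows) :
  compiles ts1 ann1 k1 rho1 -> compiles ts2 ann2 k2 rho2 ->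
  tok.1 < 10 -> iota_code n tok.1 = node2 f ->
  (forall s r r1 c, reg s 5 = Num (faddr r.+1) ->
     reg s 7 = Num (faddr r) -> reg s 8 = Num (faddr r1) -> r1 < r ->
     row_at (mem s) (faddr r + 1) (rho2 (c + k1)) ->
     row_at (mem s) (faddr r1 + 1) (rho1 c) ->
     row_source f s (faddr r.+1 + 1) (rho c)) ->
  compiles (ts1 ++ ts2 ++ [:: tok])
    (fun j c => (ann1 j c ++ ann2 (j + size ts1) (c + k1)) ++ [:: (j, rho c)])
    (k1 + k2) rho.
Proof.
move=> [Hb1 Hs1 Hr1] [Hb2 Hs2 Hr2] lt10 Ef H; rewrite catA.
split=> [|j c|j c]; last exact: rooted_cons.
  apply: (builds_snoc _ lt10 (builds_cat Hs1 Hb1 Hb2)) => [j c|s j c r Er].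
    by rewrite !size_cat Hs1 Hs2.
  case/seg_cat=> F1 F2 N.
  rewrite Hs1 in F2.
  have := rooted_frame (Hr2 _ _) F2; have := rooted_size (Hr2 j c).
  have := rooted_frame (Hr1 _ _) F1; have := rooted_size (Hr1 j c).
  rewrite Hs1 !Hs2 Ef; rewrite size_cat addnA in Er; rewrite -Er.
  case: r Er N => [|r] Er N; first lia.
  (* [r1] is the root of the first operand; the value 0 is excluded since [ts1] is nonempty. *)
  case E1: (j + size ts1) => [|r1] ? G1 ? G2; first lia.
  apply: (wp_node2 N G2 G1) => s' E5 E7 E8 A2 A1.
  by apply: H E5 E7 E8 _ A2 A1; lia.
by rewrite !size_cat Hs1 Hs2.
Qed.

Lemma compiles_node3 ts1 ann1 k1 (rho1 : rows) ts2 ann2 k2 (rho2 : rows)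
    ts3 ann3 k3 (rho3 : rows) tok f (rho : rows) :
  compiles ts1 ann1 k1 rho1 -> compiles ts2 ann2 k2 rho2 ->
  compiles ts3 ann3 k3 rho3 ->
  tok.1 < 10 -> iota_code n tok.1 = node3 f ->
  (forall s r r2 r1 c, reg s 5 = Num (faddr r.+1) ->
     reg s 7 = Num (faddr r) -> reg s 8 = Num (faddr r2) ->
     reg s 9 = Num (faddr r1) -> r1 < r2 -> r2 < r ->
     row_at (mem s) (faddr r + 1) (rho3 (c + k1 + k2)) ->
     row_at (mem s) (faddr r2 + 1) (rho2 (c + k1)) ->
     row_at (mem s) (faddr r1 + 1) (rho1 c) ->
     row_source f s (faddr r.+1 + 1) (rho c)) ->
  compiles (ts1 ++ ts2 ++ ts3 ++ [:: tok])
    (fun j c => (ann1 j c ++ ann2 (j + size ts1) (c + k1)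
       ++ ann3 (j + size ts1 + size ts2) (c + k1 + k2)) ++ [:: (j, rho c)])
    (k1 + (k2 + k3)) rho.
Proof.
move=> [Hb1 Hs1 Hr1] [Hb2 Hs2 Hr2] [Hb3 Hs3 Hr3] lt10 Ef H.
rewrite (catA ts2) (catA ts1).
split=> [|j c|j c]; last exact: rooted_cons.
  have Hs23 j c :
      size (ann2 j c ++ ann3 (j + size ts2) (c + k2)) = size (ts2 ++ ts3).
    by rewrite !size_cat Hs2 Hs3.
  apply: (builds_snoc _ lt10 (builds_cat Hs1 Hb1 (builds_cat Hs2 Hb2 Hb3)))
    => [j c|s j c r Er].
    by rewrite !size_cat Hs1 Hs2 Hs3.
  case/seg_cat=> F1 /seg_cat[F2 F3] N.
  rewrite Hs1 in F2; rewrite Hs1 Hs2 in F3.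
  have := rooted_frame (Hr3 _ _) F3; have := rooted_size (Hr3 j c).
  have := rooted_frame (Hr2 _ _) F2; have := rooted_size (Hr2 j c).
  have := rooted_frame (Hr1 _ _) F1; have := rooted_size (Hr1 j c).
  rewrite Hs1 !Hs2 !Hs3 Ef; rewrite !size_cat !addnA in Er; rewrite -Er.
  case: r Er N => [|r] Er N; first lia.
  case E2: (j + size ts1 + size ts2) => [|r2]; first lia.
  case E1: (j + size ts1) => [|r1] ? G1 ? G2 ? G3; first lia.
  apply: (wp_node3 N G3 G2 G1) => s' E5 E7 E8 E9 A3 A2 A1.
  by apply: H E5 E7 E8 E9 _ _ A3 A2 A1; lia.
by rewrite !size_cat Hs1 Hs2 Hs3.
Qed.

Lemma compiles_ext ts ann ann' k k' (rho : rows) :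
  (forall j c, ann j c = ann' j c) -> k = k' ->
  compiles ts ann k rho -> compiles ts ann' k' rho.
Proof.
move=> E <- [Hb Hs Hr]; split=> [|j c|j c]; rewrite -?E //.
exact: builds_ext Hb.
Qed.

Lemma out_tag_test b alpha :
  (out_tag (test_row Sigma b alpha) == 1) = beval alpha b.
Proof. by rewrite /= atom_leE; case: beval. Qed.

Lemma compiles_btokens b :
  compiles (btokens Sigma b) (fun j _ => bframes Sigma b j) 0
    (fun=> test_row Sigma b).
Proof.
elim: b => [||i|b IHb c IHc|b IHb c IHc|b IHb].
- apply: compiles_leaf => // s j c H; rewrite addn0; apply: (wp_leaf H).
  apply: row_source_ext (row_source_iota_const _ _) => [alpha|]; last by case: H.
  by rewrite /test_row atom_leE.
- apply: compiles_leaf => // s j c H; rewrite addn0; apply: (wp_leaf H).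
  apply: row_source_ext (row_source_iota_const _ _) => [alpha|]; last by case: H.
  by rewrite /test_row atom_leE.
- apply: compiles_leaf => // s j c H; rewrite addn0.
  case: (H) => _ E5 _ E12; apply: (wp_switch E12) => //.
  apply: (wp_leaf H); apply: row_source_ext (row_source_const _ _ _ E5) => //.
  by move=> alpha; rewrite /test_bit valK /test_row atom_leE.
- apply: compiles_ext (compiles_node2 IHb IHc _ _ _) => //=.
    by move=> j _; rewrite size_btokens.
  move=> s r r1 _ E5 E7 E8 lt A2 A1.
  apply: row_source_ext (row_source_iota_sel _ _ _ E8 _ A1
    (row_source_iota_copy _ _ E5 E7 _ A2)
    (row_source_iota_copy _ _ E5 E8 _ A1)) => //; try lia.
  move=> alpha; rewrite out_tag_test /test_row !atom_leE /=.
  by case: (beval alpha b).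
- apply: compiles_ext (compiles_node2 IHb IHc _ _ _) => //=.
    by move=> j _; rewrite size_btokens.
  move=> s r r1 _ E5 E7 E8 lt A2 A1.
  apply: row_source_ext (row_source_iota_sel _ _ _ E8 _ A1
    (row_source_iota_const _ E5)
    (row_source_iota_copy _ _ E5 E7 _ A2)) => //; try lia.
  move=> alpha; rewrite out_tag_test /test_row !atom_leE /=.
  by case: (beval alpha b).
- apply: compiles_ext (compiles_node1 IHb _ _ _) => //=.
  move=> s r _ E5 E7 A1.
  apply: row_source_ext (row_source_iota_sel _ _ _ E7 _ A1
    (row_source_iota_const _ E5) (row_source_iota_const _ E5)) => //.
  move=> alpha; rewrite out_tag_test /test_row !atom_leE /=.
  by case: (beval alpha b).
Qed.

(** Induction on [e] with one node lemma per arity; each case reduces to matching the selection made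
    by [iota_code] with the equation for [iota_row]. *)
Lemma compiles_tokens e :
  compiles (tokens e) (frames e) (nact e) (iota_row e).
Proof.
elim: e => [p|b|f IHf g IHg|b f IHf g IHg|b f IHf].
- apply: compiles_leaf => // s j c H.
  case: (H) => E1 E5 E6 E12; apply: wp_then.
  apply: wp_impl.
    by apply: (wp_leaf H); apply: row_source_act E5 E12 E1.
  move=> s' [k1 R1 R6 e' F]; apply: wp_then; apply: (wp_addc R1).
  apply: (wp_addc (m := T0 + width * c)) => //; split=> //=.
  + by move=> r Hr; rewrite -k1 //; move: Hr; rewrite !inE => /or4P[] /eqP ->.
  + by rewrite /upd /=; congr Num; rewrite mulnDr muln1 addnA.
- by apply: compiles_ext (compiles_btokens b) => //= j c; rewrite cats0.
- apply: compiles_ext (compiles_node2 IHf IHg _ _ _) => //=.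
    by move=> j c; rewrite size_tokens.
  move=> s r r1 c E5 E7 E8 lt A2 A1.
  apply: row_source_ext (row_source_iota_sel _ _ _ E8 _ A1
    (row_source_iota_copy _ _ E5 E7 _ A2)
    (row_source_iota_copy _ _ E5 E8 _ A1)) => //; try lia.
  by move=> alpha; rewrite iota_row_seq.
- apply: compiles_ext (compiles_node3 (compiles_btokens b) IHf IHg _ _ _) => //=.
    by move=> j c; rewrite size_tokens size_btokens addn0.
  move=> s r r2 r1 c E5 E7 E8 E9 lt lt' A3 A2 A1; rewrite !addn0 in A3 A2.
  apply: row_source_ext (row_source_iota_sel _ _ _ E9 _ A1
    (row_source_iota_copy _ _ E5 E8 _ A2)
    (row_source_iota_copy _ _ E5 E7 _ A3)) => //; try lia.
  by move=> alpha; rewrite out_tag_test iota_row_cond.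
- apply: compiles_ext (compiles_node2 (compiles_btokens b) IHf _ _ _) => //=.
    by move=> j c; rewrite size_btokens addn0.
  move=> s r r1 c E5 E7 E8 lt A2 A1; rewrite addn0 in A2.
  apply: row_source_ext (row_source_iota_sel _ _ _ E8 _ A1
    (row_source_iota_sel _ _ _ E7 _ A2
      (row_source_iota_const _ E5) (row_source_iota_copy _ _ E5 E7 _ A2))
    (row_source_iota_const _ E5)) => //; try lia.
  by move=> alpha; rewrite out_tag_test iota_row_loop.
Qed.

End IotaPass.

(** * Code of the second pass: continuations *)

Section ContinuationProgram.
Variable n : nat.

Definition koff : nat := 1 + width n.

(** An operator hands its continuation to operands that are visited later. [Seq] and [Loop] prefix
    it with an initial row from the first pass, and an action copies it into the table. *)
Definition cont_code (tag : nat) : cmd :=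
  match tag with
  | 6 => Then (SubC 6 6 (width n)) (row_cmd (put_copy (n := n) 6 0 5 koff))
  | 7 => Then (descend n 7 5) (Then (row_cmd (put_copy (n := n) 7 koff 5 koff))
           (Then (SubC 8 10 (fsize n)) (row_cmd (put_sel (n := n) 7 1 1
             (put_copy 8 koff 5 koff) (put_copy 8 koff 7 1)))))
  | 8 => Then (descend n 7 5) (Then (row_cmd (put_copy (n := n) 7 koff 5 koff))
           (Then (SubC 8 10 (fsize n))
             (row_cmd (put_copy (n := n) 8 koff 5 koff))))
  | 9 => Then (SubC 7 5 (fsize n)) (row_cmd (put_sel (n := n) 5 1 1
           (put_copy 7 koff 5 koff) (put_copy 7 koff 5 1)))
  | _ => Skip
  end.

Definition cont_body : cmd :=
  Then (SubC 4 4 2) (Then (SubC 5 5 (fsize n)) (Then (Fetch 11 4)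
    (Then (switch 11 cont_code 10) (SubC 0 0 1)))).

Definition cont_cost : nat := (max_steps cont_body).+1.

Lemma loop_free_cont_body : loop_free cont_body.
Proof. by rewrite /= ?loop_free_row_cmd. Qed.

End ContinuationProgram.

(** * Correctness of the second pass *)

Section ContinuationPass.
Variables (n : nat) (Sigma : Type) (T0 B : nat).
Implicit Types (s : store Sigma) (m : nat -> word Sigma).
Implicit Types (rho k : GF n Sigma nat) (b : bexp n) (e : exp n Sigma).
Local Notation width := (width n).
Local Notation fsize := (fsize n).
Local Notation koff := (koff n).
Local Notation faddr := (faddr n B).
Local Notation frame_at := (@frame_at n Sigma B).
Local Notation regs_at := (@regs_at n Sigma T0 B).

Definition kaddr i : nat := faddr i + koff.

Lemma kaddr_lt i j : i < j -> kaddr i + width <= faddr j.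
Proof. by move/(faddr_lt n B); rewrite {1}/fsize /kaddr /koff; lia. Qed.

(* The addresses that the continuation pass leaves alone when it goes through *)
(* tokens j, ..., j' - 1 and writes the rows of the states c, ..., c' - 1.    *)
Definition safe c c' j j' a : Prop :=
  (a < T0 + width * c \/ T0 + width * c' <= a) /\
  (forall i, j <= i < j' -> a < kaddr i \/ kaddr i + width <= a).

Definition same_safe c c' j j' m m' : Prop :=
  forall a, safe c c' j j' a -> m' a = m a.

Lemma same_safe_trans c c' j j' m m' m'' :
  same_safe c c' j j' m m' -> same_safe c c' j j' m' m'' ->
  same_safe c c' j j' m m''.
Proof. by move=> E E' a Ha; rewrite E' ?E. Qed.

Lemma same_safe_mono c c' j j' d d' i i' m m' :
  d <= c -> c' <= d' -> i <= j -> j' <= i' ->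
  same_safe c c' j j' m m' -> same_safe d d' i i' m m'.
Proof.
move=> dc cd ij ji E a [Ha Hb]; apply: E; split=> [|l Hl]; last by apply: Hb; lia.
have := leq_mul (leqnn width) dc; have := leq_mul (leqnn width) cd; lia.
Qed.

Lemma same_safe_cont c j j' i m m' : j <= i < j' ->
  same_but (kaddr i) width m m' -> same_safe c c j j' m m'.
Proof. by move=> Hi E a [_ Ha]; apply: E; have := Ha i Hi; lia. Qed.

Lemma token_at_safe c c' j j' m m' i tok : 2 * i.+1 <= T0 -> T0 <= B ->
  same_safe c c' j j' m m' -> token_at m i tok -> token_at m' i tok.
Proof.
move=> Hi TB E [H H']; split; rewrite E // /safe; split; try lia;
  by move=> l _; left; rewrite /kaddr; have := faddr_ge n B l; lia.
Qed.

(** Continuations occupy the end of each frame and the table lies below [B], so the data of the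
    first pass stay intact. *)
Lemma frame_at_safe c c' j j' m m' i fr : T0 + width * c' <= B ->
  same_safe c c' j j' m m' -> frame_at m i fr -> frame_at m' i fr.
Proof.
move=> TB E; have S x : x <= width -> safe c c' j j' (faddr i + x).
  move=> Hx; split; first by have := faddr_ge n B i; lia.
  move=> l _; case: (ltngtP i l) => [/kaddr_lt | /kaddr_lt | ->].
  - by rewrite /kaddr /koff; lia.
  - by lia.
  - by rewrite /kaddr /koff; lia.
case=> [H H']; split; first by rewrite E // -[faddr i]addn0; exact: S.
by apply: row_at_same H' => x Hx; rewrite E // -addnA; apply: S; lia.
Qed.

Lemma cont_at_safe c c' j j' m m' i k : T0 + width * c' <= B ->
  i < j \/ j' <= i ->
  same_safe c c' j j' m m' -> row_at m (kaddr i) k -> row_at m' (kaddr i) k.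
Proof.
move=> TB Hi E; apply: row_at_same => x Hx; apply: E; split=> [|l Hl].
  by have := faddr_ge n B i; rewrite /kaddr; lia.
have [/kaddr_lt il | /kaddr_lt li] : i < l \/ l < i by lia.
  by left; rewrite {2}/kaddr; lia.
by right; rewrite {2}/kaddr; lia.
Qed.

Lemma table_at_safe c c' j j' m m' t rho : width * t.+1 + T0 <= B ->
  t < c \/ c' <= t -> same_safe c c' j j' m m' ->
  row_at m (T0 + width * t) rho -> row_at m' (T0 + width * t) rho.
Proof.
move=> TB Ht E; apply: row_at_same => x Hx; apply: E; split=> [|l _].
  case: Ht => [tc | ct].
    by left; have := leq_mul (leqnn width) tc; rewrite mulnS; lia.
  by right; have := leq_mul (leqnn width) ct; lia.
by left; rewrite mulnS in TB; have := faddr_ge n B l; rewrite /kaddr; lia.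
Qed.

Definition ctx_regs : seq nat := [:: 0; 1; 4; 5; 14].

Lemma cont_step s q j t tok t' (P : (nat -> word Sigma) -> Prop) :
  regs_at s q.+1 j.+1 t -> token_at (mem s) j tok -> tok.1 < 10 ->
  (forall s', mem s' = mem s -> reg s' 5 = Num (faddr j) ->
     reg s' 6 = Num (T0 + width * t) ->
     wp (cont_code n tok.1) s' (fun s'' =>
       [/\ forall r, r \in ctx_regs -> reg s'' r = reg s' r,
           reg s'' 6 = Num (T0 + width * t') & P (mem s'')])) ->
  exists2 s', leads (cont_body n) s (cont_cost n) s' &
    [/\ regs_at s' q j t', reg s' 1 = reg s 1, reg s' 14 = reg s 14 & P (mem s')].
Proof.
move=> [r0 r4 r5 r6] [t1 _] lt10 H.
apply: (leads_step _ r0); first exact: loop_free_cont_body.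
apply: wp_then; apply: (wp_subc r4).
apply: wp_then; apply: (wp_subc (m := faddr j.+1)) => //; rewrite faddrS addnK.
have -> : 2 * j.+1 - 2 = 2 * j by lia.
apply: wp_then; apply: (wp_fetch (a := 2 * j)) => //.
apply: wp_then; apply: (wp_switch (i := tok.1) _ lt10); first exact: t1.
apply: wp_impl.
  by apply: H.
move=> s' [k k6 p].
apply: (wp_subc (m := q.+1)); first by rewrite k.
split=> //; last by rewrite /= /upd /= k.
  by split; rewrite //= /upd //= ?k //= /upd /= ?subn1.
by rewrite /= /upd /= k.
Qed.

Lemma skip_tokens ts : all (fun tok => tok.1 < 6) ts ->
  forall s q j t, regs_at s (size ts + q) (j + size ts) t ->
  seg (token_at (mem s)) j ts ->
  exists2 s', leads (cont_body n) s (cont_cost n * size ts) s' &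
    [/\ regs_at s' q j t, reg s' 1 = reg s 1, reg s' 14 = reg s 14
      & mem s' = mem s].
Proof.
elim/last_ind: ts => [_ s q j t | ts tok IH].
  by rewrite addn0 => H _; exists s; rewrite ?muln0 //; exact: leads_refl.
rewrite all_rcons size_rcons -cats1 => /andP[lt6 all6] s q j t.
rewrite addnS => Hr /seg_cat[Ht [Htok _]].
case: (cont_step (t' := t) (P := fun m => m = mem s) Hr Htok)
  => [|s' e' R5 R6|s1 L1 [R1 C1 N1 M1]].
- by lia.
- have -> : cont_code n tok.1 = Skip by case: tok.1 lt6 => [|[|[|[|[|[|]]]]]].
  by apply: wp_skip.
case: (IH all6 s1 q j t R1); rewrite ?M1 // => s2 L2 [R2 C2 N2 M2].
exists s2; first by rewrite mulnS; exact: leads_trans L1 L2.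
by rewrite C2 N2 M2.
Qed.

Lemma btokens_lt6 b : all (fun tok => tok.1 < 6) (btokens Sigma b).
Proof.
by elim: b => //= [b IHb c IHc|b IHb c IHc|b IHb];
  rewrite !all_cat /= ?IHb ?IHc.
Qed.

Lemma wp_cont_do s r t k :
  reg s 5 = Num (faddr r) -> reg s 6 = Num (T0 + width * t.+1) ->
  row_at (mem s) (kaddr r) k -> T0 + width * t.+1 <= B ->
  wp (cont_code n 6) s (fun s' =>
    [/\ forall r, r \in ctx_regs -> reg s' r = reg s r,
        reg s' 6 = Num (T0 + width * t)
      & row_at (mem s') (T0 + width * t) k /\
        same_but (T0 + width * t) width (mem s) (mem s')]).
Proof.
move=> R5 R6 A TB; apply: wp_then; apply: (wp_subc R6).
have -> : T0 + width * t.+1 - width = T0 + width * t by rewrite mulnS; lia.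
apply: wp_impl.
  apply: (wp_row (d := T0 + width * t) (rho := k)); rewrite -[T0 + _]addn0.
  apply: (row_source_copy (x := faddr r)) => //; first by rewrite /= addn0.
  by have := faddr_ge n B r; rewrite mulnS in TB; lia.
move=> s' [K e o]; split=> //; last by rewrite K.
by move=> q; rewrite !inE => /or4P[|||/orP[]] /eqP ->; rewrite K.
Qed.

(** Here [r] is the root of the right operand, with initial row [rho], and [i] that of the left
    operand, which receives rho |> k. *)
Lemma wp_cont_seq s r i rho k :
  reg s 5 = Num (faddr r.+1) -> frame_at (mem s) r (i.+1, rho) -> i < r ->
  row_at (mem s) (kaddr r.+1) k ->
  wp (cont_code n 7) s (fun s' =>
    [/\ forall r, r \in 6 :: ctx_regs -> reg s' r = reg s r,
        row_at (mem s') (kaddr r) k,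
        row_at (mem s') (kaddr i) (then_row rho k)
      & forall c j j', j <= i -> r < j' -> same_safe c c j j' (mem s) (mem s')]).
Proof.
move=> R5 F ir A; have [_ Frho] := F.
have r1 := kaddr_lt (ltnSn r); have ir1 := kaddr_lt ir.
have fr : faddr r <= kaddr r by exact: leq_addr.
have fr1 : faddr r.+1 <= kaddr r.+1 by exact: leq_addr.
apply: wp_then; apply: (wp_descend _ R5 F) => // s1 R7 R10 M1 K1.
rewrite -M1 in A Frho *.
apply: wp_then; apply: wp_impl.
  apply: (wp_row (rho := k) (d := kaddr r)).
  apply: (row_source_copy (x := faddr r.+1)) => //; first by rewrite K1.
  by rewrite -!/(kaddr _); lia.
move=> s2 [K2 e2 o2]; apply: wp_then.
apply: (wp_subc (m := faddr i.+1)); first by rewrite K2.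
rewrite faddrS addnK.
apply: wp_impl.
  apply: (wp_row (rho := then_row rho k) (d := kaddr i)).
  apply: (@row_source_sel n Sigma _ _ _ _ _ _ _ (faddr r) rho k rho) => //.
  - by rewrite /= /upd /= K2.
  - apply: row_at_same Frho => x Hx; rewrite e2 //; rewrite /kaddr /koff; lia.
  - by lia.
  - apply: (row_source_copy (x := faddr r.+1)) => //.
    + by rewrite /= /upd /= K2 // K1.
    + by apply: row_at_same A => x Hx; rewrite e2 // -/(kaddr _); lia.
    + by rewrite -!/(kaddr _); lia.
  - apply: (row_source_copy (x := faddr r)) => //.
    + by rewrite /= /upd /= K2.
    + apply: row_at_same Frho => x Hx; rewrite e2 //; rewrite /kaddr /koff; lia.
    + by rewrite -!/(kaddr _); lia.
move=> s3 [K3 e3 o3]; split=> //.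
- move=> q Hq; rewrite K3 ?K2 ?K1 //=; rewrite /upd; move: Hq;
  by rewrite !inE => /or4P[|||/or3P[]] /eqP -> //=; rewrite K2 ?K1.
- apply: row_at_same o2 => x Hx; rewrite e3 //; rewrite [kaddr r]/kaddr; lia.
- move=> c j j' ji rj; apply: same_safe_trans; last first.
    by apply: (same_safe_cont (i := i)) e3; lia.
  by apply: (same_safe_cont (i := r)) e2; lia.
Qed.

Lemma wp_cont_cond s r i rho k :
  reg s 5 = Num (faddr r.+1) -> frame_at (mem s) r (i.+1, rho) -> i < r ->
  row_at (mem s) (kaddr r.+1) k ->
  wp (cont_code n 8) s (fun s' =>
    [/\ forall r, r \in 6 :: ctx_regs -> reg s' r = reg s r,
        row_at (mem s') (kaddr r) k, row_at (mem s') (kaddr i) k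
      & forall c j j', j <= i -> r < j' -> same_safe c c j j' (mem s) (mem s')]).
Proof.
move=> R5 F ir A.
have r1 := kaddr_lt (ltnSn r); have ir1 := kaddr_lt ir.
have fr : faddr r <= kaddr r by exact: leq_addr.
have fr1 : faddr r.+1 <= kaddr r.+1 by exact: leq_addr.
apply: wp_then; apply: (wp_descend _ R5 F) => // s1 R7 R10 M1 K1.
rewrite -M1 in A *.
apply: wp_then; apply: wp_impl.
  apply: (wp_row (rho := k) (d := kaddr r)).
  apply: (row_source_copy (x := faddr r.+1)) => //; first by rewrite K1.
  by rewrite -!/(kaddr _); lia.
move=> s2 [K2 e2 o2]; apply: wp_then.
apply: (wp_subc (m := faddr i.+1)); first by rewrite K2.
rewrite faddrS addnK.
apply: wp_impl.
  apply: (wp_row (rho := k) (d := kaddr i)).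
  apply: (row_source_copy (x := faddr r.+1)) => //.
  - by rewrite /= /upd /= K2 // K1.
  - by apply: row_at_same A => x Hx; rewrite e2 // -/(kaddr _); lia.
  - by rewrite -!/(kaddr _); lia.
move=> s3 [K3 e3 o3]; split=> //.
- move=> q Hq; rewrite K3 ?K2 ?K1 //=; rewrite /upd; move: Hq;
  by rewrite !inE => /or4P[|||/or3P[]] /eqP -> //=; rewrite K2 ?K1.
- apply: row_at_same o2 => x Hx; rewrite e3 //; rewrite [kaddr r]/kaddr; lia.
- move=> c j j' ji rj; apply: same_safe_trans; last first.
    by apply: (same_safe_cont (i := i)) e3; lia.
  by apply: (same_safe_cont (i := r)) e2; lia.
Qed.

Lemma wp_cont_loop s r i rho k :
  reg s 5 = Num (faddr r.+1) -> frame_at (mem s) r.+1 (i, rho) ->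
  row_at (mem s) (kaddr r.+1) k ->
  wp (cont_code n 9) s (fun s' =>
    [/\ forall r, r \in 6 :: ctx_regs -> reg s' r = reg s r,
        row_at (mem s') (kaddr r) (then_row rho k)
      & forall c j j', j <= r -> r < j' -> same_safe c c j j' (mem s) (mem s')]).
Proof.
move=> R5 [_ Frho] A.
have r1 := kaddr_lt (ltnSn r).
have fr1 : faddr r.+1 <= kaddr r.+1 by exact: leq_addr.
apply: wp_then; apply: (wp_subc R5); rewrite faddrS addnK.
apply: wp_impl.
  apply: (wp_row (rho := then_row rho k) (d := kaddr r)).
  apply: (@row_source_sel n Sigma _ _ _ _ _ _ _ (faddr r.+1) rho k rho) => //.
  - by lia.
  - by apply: (row_source_copy (x := faddr r.+1)) => //; rewrite -!/(kaddr _); lia.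
  - by apply: (row_source_copy (x := faddr r.+1)) => //; rewrite -!/(kaddr _); lia.
move=> s3 [K3 e3 o3]; split=> //.
- by move=> q; rewrite !inE => /or4P[|||/or3P[]] /eqP ->; rewrite K3.
- by move=> c j j' ji rj; apply: (same_safe_cont (i := r)) e3; lia.
Qed.

Lemma esize_gt0 e : 0 < esize e.
Proof. by case: e => //=; case. Qed.

Lemma frames_rooted e j c : rooted j (iota_row e c) (frames e j c).
Proof. by case: (compiles_tokens T0 B e). Qed.

Lemma frames_root m e j c r : seg (frame_at m) j (frames e j c) ->
  j + esize e = r.+1 -> frame_at m r (j, iota_row e c).
Proof.
move=> H E; have := rooted_frame (frames_rooted e j c) H.
by rewrite size_frames E.
Qed.

Lemma tokens_safe c c' j j' m m' i ts : 2 * (i + size ts) <= T0 -> T0 <= B ->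
  same_safe c c' j j' m m' -> seg (token_at m) i ts -> seg (token_at m') i ts.
Proof.
by move=> Hi TB E; apply: seg_impl => l x Hl; apply: token_at_safe E; lia.
Qed.

Lemma frames_safe c c' j j' m m' i l : T0 + width * c' <= B ->
  same_safe c c' j j' m m' -> seg (frame_at m) i l -> seg (frame_at m') i l.
Proof. by move=> TB E; apply: seg_impl => ? ? _; apply: frame_at_safe E. Qed.

Lemma width_le c c' : c <= c' -> width * c <= width * c'.
Proof. by move=> cc; rewrite leq_mul2l cc orbT. Qed.

(** The mirror image of [builds]: the segment is entered at its root [r], where [k] is stored, and
    left at [j], while the state counter comes down from [c + nact e] to [c]. The [same_safe] clause
    protects the siblings of [e]. *)
Definition cont_ok e : Prop := forall s q j c k r, j + esize e = r.+1 ->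
  regs_at s (esize e + q) r.+1 (c + nact e) ->
  seg (token_at (mem s)) j (tokens e) ->
  seg (frame_at (mem s)) j (frames e j c) ->
  row_at (mem s) (kaddr r) k ->
  2 * r.+1 <= T0 -> T0 + width * (c + nact e) <= B ->
  exists2 s', leads (cont_body n) s (cont_cost n * esize e) s' &
    [/\ regs_at s' q j c, reg s' 1 = reg s 1, reg s' 14 = reg s 14,
        same_safe c (c + nact e) j r.+1 (mem s) (mem s')
      & forall x : pc_state (thompson e),
          row_at (mem s') (T0 + width * state_num c x)
            (then_row (delta_row c x) k)].

(** Shared by [Seq] and [Cond]. The right operand goes first; its writes avoid [kf], stored in a
    frame to its left, and the left operand then avoids the table rows of the right one. *)
Lemma cont_pair f g : cont_ok f -> cont_ok g ->
  forall s q j c kf kg i r, j + esize f = i.+1 -> i.+1 + esize g = r.+1 ->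
  regs_at s (esize f + esize g + q) r.+1 (c + (nact f + nact g)) ->
  seg (token_at (mem s)) j (tokens f) ->
  seg (token_at (mem s)) i.+1 (tokens g) ->
  seg (frame_at (mem s)) j (frames f j c) ->
  seg (frame_at (mem s)) i.+1 (frames g i.+1 (c + nact f)) ->
  row_at (mem s) (kaddr i) kf -> row_at (mem s) (kaddr r) kg ->
  2 * r.+1 <= T0 -> T0 + width * (c + (nact f + nact g)) <= B ->
  exists2 s', leads (cont_body n) s (cont_cost n * (esize f + esize g)) s' &
    [/\ regs_at s' q j c, reg s' 1 = reg s 1, reg s' 14 = reg s 14,
        same_safe c (c + (nact f + nact g)) j r.+1 (mem s) (mem s')
      & (forall x : pc_state (thompson f),
          row_at (mem s') (T0 + width * state_num c x)
            (then_row (delta_row c x) kf)) /\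
        forall y : pc_state (thompson g),
          row_at (mem s') (T0 + width * state_num (c + nact f) y)
            (then_row (delta_row (c + nact f) y) kg)].
Proof.
move=> IHf IHg s q j c kf kg i r Ei Er Hr Htf Htg Ff Fg Af Ag le.
rewrite addnA in Hr *; rewrite -addnA (addnCA (esize f)) in Hr => TB.
have Wf := width_le (leq_addr (nact g) (c + nact f)).
case: (IHg _ _ _ _ _ _ Er Hr Htg Fg Ag le TB) => s1 L1 [R1 C1 N1 E1 A1].
have TB0 : T0 <= B by lia.
have {}Htf : seg (token_at (mem s1)) j (tokens f).
  by apply: tokens_safe E1 Htf => //; rewrite size_tokens; lia.
have {}Ff := frames_safe TB E1 Ff.
have {}Af : row_at (mem s1) (kaddr i) kf by apply: cont_at_safe E1 Af; lia.
case: (IHf _ _ _ _ _ _ Ei R1 Htf Ff Af _ _)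
  => [||s2 L2 [R2 C2 N2 E2 A2]]; try lia.
exists s2; first by rewrite addnC mulnDr; exact: leads_trans L1 L2.
split=> //; try congruence.
- apply: same_safe_trans.
    by apply: same_safe_mono E1; lia.
  by apply: same_safe_mono E2; lia.
- split=> // y; have := state_num_range (c + nact f) y => Hy.
  apply: table_at_safe E2 (A1 y); last lia.
  have : state_num (c + nact f) y < c + nact f + nact g by lia.
  by move/width_le; lia.
Qed.

Lemma cont_okP e : cont_ok e.
Proof.
elim: e => [p|b|f IHf g IHg|b f IHf g IHg|b f IHf] s q j c k r.
(* The state of an action accepts at every atom, so its row followed by [k] is [k] by
   computation. *)
- rewrite /= !addn1 => -[<-] Hr [Ht _] _ A le TB.
  case: (cont_step (t' := c) (P := fun m =>
      row_at m (T0 + width * c) k /\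
      same_but (T0 + width * c) width (mem s) m) Hr Ht)
    => // [s' M R5 R6|s1 L1 [R1 C1 N1 [A1 E1]]].
    by rewrite -M in A *; exact: wp_cont_do R5 R6 A TB.
  exists s1; first by rewrite muln1.
  by split=> // a [Ha _]; rewrite mulnS in Ha; apply: E1; lia.
- rewrite /= addn0 -(size_btokens Sigma b) => <- Hr Ht _ _ _ _.
  case: (skip_tokens (btokens_lt6 b) Hr Ht) => s1 L1 [R1 C1 N1 M1].
  by exists s1 => //; split=> //; rewrite M1.
- move=> Er Hr; rewrite /= => /seg_cat[Htf /seg_cat[Htg [Ht _]]] F A le TB.
  case/seg_cat: F => /seg_cat[Ff Fg] _.
  have Pf := esize_gt0 f; have Pg := esize_gt0 g.
  rewrite !size_tokens in Htg Ht; rewrite size_frames in Fg.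
  rewrite /= in Er Hr; case: r Er A Hr le => [|r] Er A Hr le; first lia.
  case Ei : (j + esize f) Htg Ht Fg => [|i] Htg Ht Fg; first lia.
  have Eg : i.+1 + esize g = r.+1 by lia.
  rewrite Eg in Ht.
  case: (cont_step (t' := c + (nact f + nact g)) (P := fun m =>
     [/\ row_at m (kaddr r) k,
         row_at m (kaddr i) (then_row (iota_row g (c + nact f)) k)
       & same_safe c c j r.+2 (mem s) m]) Hr Ht)
    => // [s' M R5 R6|s1 L1 [R1 C1 N1 [Ag Af E1]]].
    have Fr := frames_root Fg Eg; have ir : i < r by lia.
    rewrite -M in A Fr *; apply: wp_impl (wp_cont_seq R5 Fr ir A) _.
    move=> s'' [K Ag Af E]; split=> //.
    + by move=> x Hx; rewrite K // inE Hx orbT.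
    + by rewrite K.
    + by split=> //; apply: E; lia.
  have TB0 : T0 + width * c <= B.
    by have := width_le (leq_addr (nact f + nact g) c); lia.
  have E1' : same_safe c c j r.+2 (mem s) (mem s1) by [].
  case: (cont_pair IHf IHg Ei Eg R1 _ _ _ _ Af Ag _ TB)
    => [|||||s2 L2 [R2 C2 N2 E2 [Af2 Ag2]]].
  + by apply: tokens_safe E1 Htf; rewrite ?size_tokens; lia.
  + by apply: tokens_safe E1 Htg; rewrite ?size_tokens; lia.
  + exact: frames_safe E1 Ff.
  + exact: frames_safe E1 Fg.
  + by lia.
  exists s2; first by rewrite mulnS; exact: leads_trans L1 L2.
  split=> //; try congruence.
  + apply: same_safe_trans.
      by apply: same_safe_mono E1; lia.
    by apply: same_safe_mono E2; lia.
  + case=> [x|y].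
      by apply: row_at_ext (Af2 x) => alpha; rewrite delta_row_seql.
    by apply: row_at_ext (Ag2 y) => alpha; rewrite /then_row delta_row_seqr.
- move=> Er Hr; rewrite /= => /seg_cat[Htb /seg_cat[Htf /seg_cat[Htg [Ht _]]]].
  move=> F A le TB.
  case/seg_cat: F => /seg_cat[_ /seg_cat[Ff Fg]] _.
  have Pf := esize_gt0 f; have Pg := esize_gt0 g.
  rewrite size_bframes in Ff Fg; rewrite size_frames in Fg.
  rewrite !size_btokens in Htf Htg Ht; rewrite !size_tokens in Htg Ht.
  rewrite /= in Er Hr; case: r Er A Hr le => [|r] Er A Hr le; first lia.
  case Ei : (j + bsize b + esize f) Htg Ht Fg => [|i] Htg Ht Fg; first lia.
  have Eg : i.+1 + esize g = r.+1 by lia.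
  rewrite Eg in Ht.
  (* The tokens of [b] open the segment and so come last in this pass: they still count as tokens
     left while [f] and [g] are treated. *)
  have Eq :
    bsize b + esize f + esize g + q = esize f + esize g + (bsize b + q) by lia.
  rewrite addSn Eq in Hr.
  case: (cont_step (t' := c + (nact f + nact g)) (P := fun m =>
     [/\ row_at m (kaddr r) k, row_at m (kaddr i) k
       & same_safe c c j r.+2 (mem s) m]) Hr Ht)
    => // [s' M R5 R6|s1 L1 [R1 C1 N1 [Ag Af E1]]].
    have Fr := frames_root Fg Eg; have ir : i < r by lia.
    rewrite -M in A Fr *; apply: wp_impl (wp_cont_cond R5 Fr ir A) _.
    move=> s'' [K Ag Af E]; split=> //.
    + by move=> x Hx; rewrite K // inE Hx orbT.
    + by rewrite K.
    + by split=> //; apply: E; lia.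
  have TB0 : T0 + width * c <= B.
    by have := width_le (leq_addr (nact f + nact g) c); lia.
  case: (cont_pair IHf IHg Ei Eg R1 _ _ _ _ Af Ag _ TB)
    => [|||||s2 L2 [R2 C2 N2 E2 [Af2 Ag2]]].
  + by apply: tokens_safe E1 Htf; rewrite ?size_tokens; lia.
  + by apply: tokens_safe E1 Htg; rewrite ?size_tokens; lia.
  + exact: frames_safe E1 Ff.
  + exact: frames_safe E1 Fg.
  + by lia.
  have E12 : same_safe c (c + (nact f + nact g)) j r.+2 (mem s) (mem s2).
    apply: same_safe_trans.
      by apply: same_safe_mono E1; lia.
    by apply: same_safe_mono E2; lia.
  rewrite -(size_btokens Sigma b) in R2.
  case: (skip_tokens (btokens_lt6 b) R2) => [|s3 L3 [R3 C3 N3 M3]].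
    by apply: tokens_safe E12 Htb; rewrite ?size_btokens; lia.
  exists s3.
    rewrite (_ : cont_cost n * _ = cont_cost n +
      (cont_cost n * (esize f + esize g) + cont_cost n * bsize b));
      last by rewrite mulnS !mulnDr; lia.
    by apply: leads_trans L1 (leads_trans L2 _); rewrite -(size_btokens Sigma b).
  rewrite M3; split=> //; try congruence.
  case=> [x|y].
    by apply: row_at_ext (Af2 x) => alpha; rewrite /then_row delta_row_condl.
  by apply: row_at_ext (Ag2 y) => alpha; rewrite /then_row delta_row_condr.
- move=> Er Hr; rewrite /= => /seg_cat[Htb /seg_cat[Htf [Ht _]]] F A le TB.
  have Fr := frames_root (e := Loop b f) F Er.
  case/seg_cat: F => /seg_cat[_ Ff] _.
  have Pf := esize_gt0 f.
  rewrite size_bframes in Ff.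
  rewrite !size_btokens in Htf Ht; rewrite size_tokens in Ht.
  rewrite /= in Er Hr; case: r Er A Hr Fr le => [|r] Er A Hr Fr le; first lia.
  have Ef : j + bsize b + esize f = r.+1 by lia.
  rewrite Ef in Ht.
  have Eq : bsize b + esize f + q = esize f + (bsize b + q) by lia.
  rewrite addSn Eq in Hr.
  case: (cont_step (t' := c + nact f) (P := fun m =>
     row_at m (kaddr r) (then_row (iota_row (Loop b f) c) k) /\
     same_safe c c j r.+2 (mem s) m) Hr Ht)
    => // [s' M R5 R6|s1 L1 [R1 C1 N1 [Af E1]]].
    rewrite -M in A Fr *; apply: wp_impl (wp_cont_loop R5 Fr A) _.
    move=> s'' [K Af E]; split=> //.
    + by move=> x Hx; rewrite K // inE Hx orbT.
    + by rewrite K.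
    + by split=> //; apply: E; lia.
  have TB0 : T0 + width * c <= B by have := width_le (leq_addr (nact f) c); lia.
  case: (IHf _ _ _ _ _ _ Ef R1 _ _ Af _ TB) => [|||s2 L2 [R2 C2 N2 E2 A2]].
  + by apply: tokens_safe E1 Htf; rewrite ?size_tokens; lia.
  + exact: frames_safe E1 Ff.
  + by lia.
  have E12 : same_safe c (c + nact f) j r.+2 (mem s) (mem s2).
    apply: same_safe_trans.
      by apply: same_safe_mono E1; lia.
    by apply: same_safe_mono E2; lia.
  rewrite -(size_btokens Sigma b) in R2.
  case: (skip_tokens (btokens_lt6 b) R2) => [|s3 L3 [R3 C3 N3 M3]].
    by apply: tokens_safe E12 Htb; rewrite ?size_btokens; lia.
  exists s3.
    rewrite (_ : cont_cost n * _ = cont_cost n + (cont_cost n * esize f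
      + cont_cost n * bsize b));
      last by rewrite mulnS !mulnDr; lia.
    by apply: leads_trans L1 (leads_trans L2 _); rewrite -(size_btokens Sigma b).
  rewrite M3; split=> //; try congruence.
  by move=> x; apply: row_at_ext (A2 x) => alpha; rewrite -delta_row_loop.
Qed.

End ContinuationPass.

(** * The assembled program and its linear cost *)

Section Program.
Variables (n : nat) (Sigma : Type).
Implicit Types (s : store Sigma) (c : cmd) (e : exp n Sigma).
Local Notation width := (width n).

Definition runs c s d (Q : store Sigma -> Prop) : Prop :=
  exists t s', [/\ exec c s t s', t <= d & Q s'].

Lemma runs_then c c' s d d' Q :
  runs c s d (fun s' => runs c' s' d' Q) -> runs (Then c c') s (d + d') Q.
Proof.
move=> [t [s' [E le [t' [s'' [E' le' q]]]]]].
by exists (t + t'), s''; split=> //; [exact: exec_then E E' | exact: leq_add].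
Qed.

Lemma runs_wp c s Q : loop_free c -> wp c s Q -> runs c s (max_steps c) Q.
Proof.
by move=> lf [t [s' [E q]]]; exists t, s'; split=> //; exact: exec_max_steps E lf.
Qed.

Lemma runs_while c s d s' (Q : store Sigma -> Prop) :
  leads c s d s' -> reg s' 0 = Num 0 -> Q s' -> runs (While 0 c) s d.+1 Q.
Proof. by move=> L E q; case: (leads_exec L E) => t Et le; exists t, s'. Qed.

Lemma runs_le c s d d' Q : d <= d' -> runs c s d Q -> runs c s d' Q.
Proof. by move=> dd [t [s' [E le q]]]; exists t, s'; split=> //; lia. Qed.

Lemma input_tokens e : seg (token_at (mem (input_store e))) 0 (tokens e).
Proof.
rewrite /= /input_words.
suff H (ts : seq (nat * word Sigma)) pre j : size pre = 2 * j ->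
    seg (token_at (nth (Num 0)
      (pre ++ flatten [seq [:: Num tok.1; tok.2] | tok <- ts]))) j ts.
  exact: (H (tokens e) [::] 0).
elim: ts pre j => //= tok ts IH pre j E; split.
  split; rewrite nth_cat E.
    by rewrite ltnn subnn.
  by rewrite ltnNge leq_addr /= addKn.
rewrite -[_ :: _ :: _]/([:: Num tok.1; tok.2] ++ _) catA; apply: IH.
by rewrite size_cat E mulnS addnC.
Qed.

(** Without multiplication, the base addresses of table and frames are accumulated by constant
    additions, once per token. *)
Definition layout_body : cmd :=
  Then (AddC 6 6 2) (Then (AddC 5 5 (2 + width)) (SubC 0 0 1)).

Lemma layout_loop q s x y : reg s 0 = Num q ->
  reg s 6 = Num x -> reg s 5 = Num y ->
  exists2 s', leads layout_body s ((max_steps layout_body).+1 * q) s' &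
    [/\ reg s' 0 = Num 0, reg s' 6 = Num (x + 2 * q),
        reg s' 5 = Num (y + (2 + width) * q), reg s' 13 = reg s 13
      & mem s' = mem s].
Proof.
elim: q s x y => [|q IH] s x y E0 E6 E5.
  by exists s; rewrite !muln0 ?addn0 //; exact: leads_refl.
have [] // := @leads_step _ layout_body s q (fun s' =>
  [/\ reg s' 0 = Num q, reg s' 6 = Num (x + 2), reg s' 5 = Num (y + (2 + width)),
      reg s' 13 = reg s 13 & mem s' = mem s]).
  apply: wp_then; apply: (wp_addc E6); apply: wp_then.
  apply: (wp_addc (m := y)) => //; apply: (wp_subc (m := q.+1)) => //.
  by split; rewrite //= /upd /= subn1.
move=> s1 L1 [F0 F6 F5 F13 M1].
have [s2 L2 [G0 G6 G5 G13 M2]] := IH _ _ _ F0 F6 F5.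
exists s2; first by rewrite mulnS; exact: leads_trans L1 L2.
by rewrite G6 G5 !mulnS !addnA G13 M2.
Qed.

Definition setup : cmd := Then (Move 13 0) (Then (Const 6 0) (Const 5 width)).

(** Row 0 of the table is reserved for the start state, so the first action gets number 1. *)
Definition start_iota : cmd :=
  Then (AddC 6 6 width) (Then (Const 1 1) (Then (Const 4 0) (Move 0 13))).

Definition start_cont : cmd :=
  Then (SubC 14 5 (fsize n))
    (Then (row_cmd (put_const (n := n) 14 (koff n) (fun=> true))) (Move 0 13)).

(** The second pass leaves register 6 at row 1. Register 2 is set last because the row operations
    use it as scratch. *)
Definition write_start : cmd :=
  Then (SubC 6 6 width) (Then (row_cmd (put_copy (n := n) 6 0 14 1))
    (Then (Move 0 6) (Const 2 0))).

Definition thompson_program : cmd :=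
  Then setup (Then (While 0 layout_body) (Then start_iota
    (Then (While 0 (iota_body n)) (Then start_cont
      (Then (While 0 (cont_body n)) write_start))))).

Definition thompson_cost : nat :=
  max_steps setup + max_steps start_iota + max_steps start_cont
  + max_steps write_start + 3
  + (max_steps layout_body).+1 + iota_cost n + cont_cost n.

Definition accept_row : GF n Sigma nat := fun=> inl true.

Lemma runs_thompson_program e :
  runs thompson_program (input_store e) (thompson_cost * esize e)
    (fun s => exists T0,
      [/\ reg s 0 = Num T0, reg s 1 = Num (1 + nact e), reg s 2 = Num 0,
          row_at (mem s) T0 (iota_row e 1)
        & forall x : pc_state (thompson e),
            row_at (mem s) (T0 + width * state_num 1 x)
              (then_row (delta_row 1 x) accept_row)]).
Proof.
set N := esize e.
have N0 : 0 < N by exact: esize_gt0.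
apply: (@runs_le _ _ (max_steps setup + (((max_steps layout_body).+1 * N).+1 +
  (max_steps start_iota + ((iota_cost n * N).+1 + (max_steps start_cont +
     ((cont_cost n * N).+1 + max_steps write_start))))))).
  (* The straight-line phases and the three final loop tests are paid once; as [N] is positive, each
     is at most [N] times itself. *)
  rewrite /thompson_cost; move: (max_steps setup) (max_steps start_iota)
    (max_steps start_cont) (max_steps write_start) (max_steps layout_body)
    (iota_cost n) (cont_cost n) => a1 a2 a3 a4 a5 a6 a7.
  rewrite !mulnDl; have P x : x <= x * N by exact: leq_pmulr.
  by have := P a1; have := P a2; have := P a3; have := P a4; have := P 3; lia.
have lfc := loop_free_row_cmd.
apply: runs_then; apply: runs_wp => //.
apply: wp_then; apply: wp_move; apply: wp_then; do 2!apply: wp_const.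
apply: runs_then; set s0 := set_reg _ _ _.
have [||| s1 L1 [F0 F6 F5 F13 M1]] := @layout_loop N s0 0 width => //.
  by rewrite /= /upd /= size_tokens.
apply: (runs_while L1 F0); rewrite add0n in F6.
apply: runs_then; apply: runs_wp => //.
apply: wp_then; apply: (wp_addc F6); apply: wp_then; apply: wp_const.
apply: wp_then; apply: wp_const; apply: wp_move.
set s2 := set_reg _ _ _.
(* [B] leaves room for [N + 1] table rows above the [2 * N] input words, enough because [nact e] is
   at most [N]. *)
set T0 := 2 * N; set B := width + (2 + width) * N in F5.
have TB : T0 + width * (1 + nact e) <= B.
  have : width * nact e <= width * N by rewrite leq_mul2l nact_le_esize orbT.
  by rewrite /B /T0 mulnDr mulnDl muln1; lia.
have [Hb Hs _] := compiles_tokens T0 B e.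
apply: runs_then.
have R2 : @regs_at n Sigma T0 B s2 (size (tokens e) + 0) 0 1.
  split; rewrite /= /upd //=.
  - by rewrite F13 /= /upd /= addn0.
  - by rewrite /= F5 /faddr muln0 addn0.
  - by rewrite muln1.
case: (Hb s2 0 0 1 R2) => [//|||s3 L3 [[G0 G4 G5 G6] G1 G13 M3 F3]].
- by rewrite /= M1; exact: input_tokens.
- by rewrite size_tokens; lia.
rewrite size_tokens add0n -/N in L3 G4 G5 G6.
apply: (runs_while L3 G0); apply: runs_then.
have [r Er] : exists r, N = r.+1 by exists N.-1; lia.
rewrite Er in G5.
apply: runs_wp; first by rewrite /= lfc.
apply: wp_then; apply: (wp_subc G5); rewrite faddrS addnK.
set s4 := set_reg _ _ _.
apply: wp_then; apply: wp_impl.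
  apply: (wp_row (rho := accept_row) (d := kaddr n B r)).
  by apply: row_source_const.
move=> s5 [K5 e5 A5]; apply: wp_move; set s6 := set_reg _ _ _.
have E6 : same_safe n T0 B 1 1 0 r.+1 (mem s3) (mem s6).
  by apply: (same_safe_cont (i := r)) e5; lia.
have TB1 : T0 + width * 1 <= B by rewrite mulnDr in TB; lia.
have Ht : seg (token_at (mem s6)) 0 (tokens e).
  apply: tokens_safe E6 _; rewrite ?size_tokens; [lia | lia |].
  apply: seg_impl (input_tokens e) => i x; rewrite add0n size_tokens => Hi H.
  apply: token_at_same_below M3 _; last by rewrite /= M1.
  by have := faddr_ge n B 0; lia.
have Fr := frames_safe TB1 E6 F3.
have R6 : @regs_at n Sigma T0 B s6 (esize e + 0) r.+1 (1 + nact e).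
  split; rewrite /= /upd //= K5 //= /upd /=.
  - by rewrite G13 /= /upd /= F13 /= /upd /= size_tokens addn0.
  - by rewrite -Er.
have Er0 : 0 + esize e = r.+1 by [].
have [| s7 L7 [[H0 H4 H5 H6] H1 H14 E7 A7]] :=
  cont_okP Er0 R6 Ht Fr A5 _ TB; first by lia.
apply: runs_then; apply: (runs_while L7 H0).
apply: runs_wp; first by rewrite /= lfc.
apply: wp_then; apply: (wp_subc H6); apply: wp_then; apply: wp_impl.
  apply: (wp_row (rho := iota_row e 1) (d := T0)).
  rewrite -[X in row_source _ _ X _]addn0.
  apply: (row_source_copy (x := faddr n B r)) => //.
  - by rewrite /= muln1 addnK.
  - by rewrite /= /upd /= H14 /= /upd /= K5.
  - have : frame_at B (mem s7) r (0, iota_row e 1).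
      exact: frames_root (frames_safe TB E7 Fr) Er0.
    by case.
  - by have := faddr_ge n B r; rewrite addn0; lia.
move=> s8 [K8 E8 A8]; apply: wp_then; apply: wp_move; apply: wp_const.
exists T0; split=> //=; rewrite /upd /=.
- by rewrite K8 //= /upd /= muln1 addnK.
- by rewrite K8 //= /upd /= H1 /= /upd /= K5 //= /upd /= G1.
- move=> x; apply: row_at_same (A7 x) => i Hi; apply: E8.
  have /andP[/(leq_mul (leqnn width))] := state_num_range 1 x; rewrite muln1; lia.
Qed.

Lemma stored_out_map X (f : X -> nat) m a (o : bool + Sigma * X) :
  stored_out id m a (out_map f o) -> stored_out f m a o.
Proof. by case: o => [v|[p x]]. Qed.

End Program.

Theorem proposition4p2 (n : nat) (Sigma : Type)
    (n_gt0 : 0 < n) (Sigma_nonempty : inhabited Sigma) :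
  [/\ constructible_in_linear_time (@thompson_automaton n Sigma),
      forall e : exp n Sigma,
        #|state (thompson_automaton e)| = nact e + 1 &
      exists C : nat, forall e : exp n Sigma,
        #|state (thompson_automaton e)| <= C * esize e].
Proof.
have card e : #|state (@thompson_automaton n Sigma e)| = 1 + nact e.
  by rewrite /= card_sum card_unit card_thompson.
split=> [|e|]; first last.
(* One [esize e] bounds [nact e], the other pays for the start state. *)
- exists 2 => e; rewrite card.
  by have := nact_le_esize e; have := esize_gt0 e; lia.
- by rewrite card addnC.
exists (thompson_program n), (thompson_cost n) => e.
case: (runs_thompson_program e) => t [s [Et le [T0 [R0 R1 R2 A0 A]]]].
exists t, s; split=> //.
(* The numbering by table rows; it is injective into a set of the same size, hence bijective. *)
pose num (z : state (thompson_automaton e)) : nat :=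
  match z : (unit + pc_state (thompson e))%type with
  | inl _ => 0
  | inr x => state_num 1 x
  end.
have num_lt z : num z < #|state (thompson_automaton e)|.
  by rewrite card; case: z => [//|x] /=; have := state_num_range 1 x; lia.
have num_inj : injective num.
  case=> [[]|x] [[]|y] //= E.
  - by have := state_num_range 1 y; lia.
  - by have := state_num_range 1 x; lia.
  - by rewrite (state_num_inj E).
exists T0, (fun z => Ordinal (num_lt z)); split; rewrite ?card //.
  apply: inj_card_bij; first by move=> x y [/num_inj].
  by rewrite card_ord.
have addr z alpha : T0 + 3 * (num z * #|At n| + enum_rank alpha) =
    T0 + width n * num z + slot alpha.
  by rewrite mulnDr /width /slot -addnA -(mulnA 3) (mulnC #|_|).
move=> z alpha; apply: stored_out_map; rewrite addr.
case: z => [[]|x] /=; rewrite /gmap.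
- by rewrite muln0 addn0; move: (A0 alpha); rewrite /iota_row /gmap;
    case: (pc_iota _ alpha) => [v|[p x]].
- move: (A x alpha); rewrite /then_row /delta_row /gmap /accept_row.
  by case: (pc_delta x alpha) => [[]|[p y]].
Qed.
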